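(* Let $V$ be an $\mathbb{N}$-graded vertex algebra and $M$ an $A(V)$-module. Then in $S_1(M)$, the image of $M$ (the degree-$0$ subspace $(S_1(M))_{(0)}$) intersects $\mathcal{J}$ trivially: $\mathcal{J}\cap M=0$.
   Context: An $\mathbb{N}$-graded vertex algebra is a vertex algebra $(V,Y,\mathbf{1})$ with $V=\coprod_{n\in\mathbb{Z}}V_{(n)}$, $V_{(n)}=0$ for $n<0$, and $[d,Y(u,x)]=x\frac{d}{dx}Y(u,x)+Y(du,x)$ where $du=nu$ for $u\in V_{(n)}$; write $\mathrm{wt}\,u=n$ for $u\in V_{(n)}$, $Y(u,x)=\sum_nu_nx^{-n-1}$, and $L(0)=d$, so $x^{L(0)}u=x^{\mathrm{wt}\,u}u$ for homogeneous $u$. Zhu's algebra: $O(V)$ is the span of $\mathrm{Res}_xx^nY((x+1)^{L(0)}u,x)v$ for $u,v\in V$, $n\le-2$; $A(V)=V/O(V)$ with associative product $u*v=\mathrm{Res}_xx^{-1}Y((x+1)^{L(0)}u,x)v$. Construction: let $\rho$ be the representation of $A(V)$ on $M$. In $V[t,t^{-1}]=V\otimes\mathbb{C}[t,t^{-1}]$ write $u(m)=u\otimes t^m$; let $T(V[t,t^{-1}])$ be its tensor algebra, acting on the left on $T(V[t,t^{-1}])\otimes M$, which is spanned by $u_1(m_1)\cdots u_r(m_r)w$ ($w\in M$) of degree $\sum_i(\mathrm{wt}\,u_i-m_i-1)$ for homogeneous $u_i$ (elements of $M$ have degree $0$). Put $Y_t(u,x)=\sum_mu(m)x^{-m-1}$,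 $o_t(u)=u(\mathrm{wt}\,u-1)$ for homogeneous $u$. Let $\mathcal{I}$ be the $T(V[t,t^{-1}])$-submodule generated by: (1) $u(m)w$ for homogeneous $u$ and homogeneous $w\in T(V[t,t^{-1}])\otimes M$ with $\mathrm{wt}\,u-m-1+\deg w<0$; (2) $o_t(u)w-\rho(u+O(V))w$ for $u\in V$, $w\in M$; (3) $u(p)v(q)w-\sum_{i=0}^{\mathrm{wt}\,v+\deg w-q-1}\sum_{j=0}^{\mathrm{wt}\,u+\deg w}\binom{p-\mathrm{wt}\,u-\deg w}{i}\binom{\mathrm{wt}\,u+\deg w}{j}(u_{p-\mathrm{wt}\,u-\deg w-i+j}v)(q+\mathrm{wt}\,u+\deg w+i-j)w$ for homogeneous $u,v$, homogeneous $w$, $p,q\in\mathbb{Z}$ with $\mathrm{wt}\,v+\deg w>q$ and $\mathrm{wt}\,u-p-1+\mathrm{wt}\,v-q-1+\deg w\ge0$. $S_1(M)=(T(V[t,t^{-1}])\otimes M)/\mathcal{I}$, a graded $T(V[t,t^{-1}])$-module, with $Y_{S_1(M)}$ induced by $Y_t$; $M$ is identified with its image (the degree-$0$ part) in $S_1(M)$. $\mathcal{J}$ is the $T(V[t,t^{-1}])$-submodule of $S_1(M)$ generated by $\sum_{j=0}^{\mathrm{wt}\,u+\deg w}\binom{\mathrm{wt}\,u+\deg w}{j}(u_{p-i-j}v)(q+i+j)w$ (i.e. $\mathrm{Res}_{x_0}\mathrm{Res}_{x_2}x_0^{p-\mathrm{wt}\,u-\deg w-i}x_2^{q+i}(x_0+x_2)^{\mathrm{wt}\,u+\deg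 w}Y_{S_1(M)}(Y(u,x_0)v,x_2)w$) for homogeneous $u,v\in V$, homogeneous $w\in S_1(M)$, $p,q\in\mathbb{Z}$ and integers $i\ge\mathrm{wt}\,v+\deg w-q$. *)

(* Defs.v *)
(* Base field: C := R[i] (complex numbers over an arbitrary
   realType R, i.e. the field of complex numbers).  Definitions below are
   stated for an arbitrary field K and instantiated at R[i]. *)
From HB Require Import structures.
From mathcomp Require Import all_boot all_order all_algebra.
From mathcomp Require Import reals.
From mathcomp Require Import complex.
Set Implicit Arguments. Unset Strict Implicit. Unset Printing Implicit Defensive.
Import Order.TTheory GRing.Theory Num.Theory.
Local Open Scope ring_scope.

Section VA.
Variable K : fieldType.

Definition binz (n : int) (i : nat) : K :=
  (\prod_(j < i) (n%:~R - (j%:R : K))) / (i`!)%:R.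

Definition nrange (n : int) : nat := if (n < 0)%R then 0%N else (absz n).+1.

Variable V : lmodType K.
(* grading: proj k = projection of V onto V_(k), k : nat (V_(n) = 0 for n<0) *)
Variable proj : nat -> V -> V.
(* modes: mode u n v = u_n v, where Y(u,x) = sum_n u_n x^{-n-1} *)
Variable mode : V -> int -> V -> V.
Variable vac : V.

Definition projz (n : int) (v : V) : V :=
  match n with Posz k => proj k v | Negz _ => 0 end.

Definition is_grading : Prop :=
  [/\ (forall k a u v, proj k (a *: u + v) = a *: proj k u + proj k v),
      (forall k l v, proj k (proj l v) = if k == l then proj l v else 0) &
      (forall v, exists N : nat,
          (forall k, (N <= k)%N -> proj k v = 0) /\ v = \sum_(k < N) proj k v)].

(* Borcherds (component form of the Jacobi) identity for l m n, with all sums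
   truncated at an N beyond which every summand vanishes *)
Definition borcherds (u v w : V) (l m n : int) : Prop :=
  forall N : nat,
    (forall i : nat, (N <= i)%N ->
       [/\ mode u (l + i%:Z) v = 0, mode v (n + i%:Z) w = 0 &
           mode u (m + i%:Z) w = 0]) ->
    \sum_(i < N) binz m i *: mode (mode u (l + i%:Z) v) (m + n - i%:Z) w =
    \sum_(i < N) ((-1) ^+ i * binz l i) *:
        (mode u (l + m - i%:Z) (mode v (n + i%:Z) w)
         - (-1) ^ l *: mode v (l + n - i%:Z) (mode u (m + i%:Z) w)).

Definition is_Ngraded_VA : Prop :=
  is_grading /\
  (forall n a u u' v, mode (a *: u + u') n v = a *: mode u n v + mode u' n v) /\
  (forall n a u v v', mode u n (a *: v + v') = a *: mode u n v + mode u n v') /\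
  (forall u v, exists N : int, forall n, (N <= n)%R -> mode u n v = 0) /\
  (forall n v, mode vac n v = if n == -1 then v else 0) /\
  (forall u, mode u (-1) vac = u /\ forall n, (0 <= n)%R -> mode u n vac = 0) /\
  (forall u v w l m n, borcherds u v w l m n) /\
  (* [d, Y(u,x)] = x d/dx Y(u,x) + Y(du,x), i.e. wt (u_n v) = wt u + wt v - n - 1 *)
  (forall k l u v n, proj k u = u -> proj l v = v ->
     projz (k%:Z + l%:Z - n - 1) (mode u n v) = mode u n v).

(* Res_x x^n Y((x+1)^{L(0)} u, x) v  for u homogeneous of weight k *)
Definition zhu_circ (k : nat) (n : int) (u v : V) : V :=
  \sum_(j < k.+1) 'C(k, j)%:R *: mode u (n + j%:Z) v.

(* u * v = Res_x x^{-1} Y((x+1)^{L(0)} u, x) v  for u homogeneous of weight k *)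
Definition zhu_star (k : nat) (u v : V) : V :=
  \sum_(j < k.+1) 'C(k, j)%:R *: mode u (j%:Z - 1) v.

Variable M : lmodType K.
(* rho u = rho(u + O(V)) : the action of A(V) = V/O(V) on M, given through
   its composition with the projection V -> A(V) *)
Variable rho : V -> M -> M.

Definition is_AV_module : Prop :=
  [/\ (forall a u u' w, rho (a *: u + u') w = a *: rho u w + rho u' w),
      (forall a u w w', rho u (a *: w + w') = a *: rho u w + rho u w'),
      (* rho vanishes on O(V) (O(V) is spanned by the zhu_circ elements,
         u homogeneous, n <= -2), so it factors through A(V) *)
      (forall k n u v w, proj k u = u -> (n <= -2)%R -> rho (zhu_circ k n u v) w = 0),
      (forall k u v w, proj k u = u -> rho (zhu_star k u v) w = rho u (rho v w)) &
      (forall w, rho vac w = w)].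

(* The space T(V[t,t^-1]) (x) M, realized as the free vector space on pairs
   (word, w), a word  [:: (u_1,m_1); ...; (u_r,m_r)]  standing for
   u_1(m_1) ... u_r(m_r),  modulo the multilinearity relations (which are
   added to the relations generating I and J below).  A formal linear
   combination is a list of (coefficient, basis pair). *)
Definition word := seq (V * int).
Definition fcomb := seq (K * (word * M)).

Definition fcoef (s : fcomb) (b : word * M) : K := \sum_(x <- s | x.2 == b) x.1.

Definition fc_eq (s t : fcomb) : Prop := forall b, fcoef s b = fcoef t b.

(* the element  sum_x  c_x * a_x . g_x  of the free space, where a . g is the
   left action of the word a (left multiplication in the tensor algebra) *)
Definition lincomb (l : seq (K * (word * fcomb))) : fcomb :=
  flatten [seq [seq (x.1 * y.1, (x.2.1 ++ y.2.1, y.2.2)) | y <- x.2.2] | x <- l].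

Definition in_submod (G : fcomb -> Prop) (s : fcomb) : Prop :=
  exists l : seq (K * (word * fcomb)),
    (forall x, x \in l -> G x.2.2) /\ fc_eq s (lincomb l).

Definition multilin_rel (g : fcomb) : Prop :=
  (exists (a : K) (u u' : V) (m : int) (b : word) (w : M),
     g = [:: (1, ((a *: u + u', m) :: b, w)); (- a, ((u, m) :: b, w));
            (-1, ((u', m) :: b, w))]) \/
  (exists (a : K) (b : word) (w w' : M),
     g = [:: (1, (b, a *: w + w')); (- a, (b, w)); (-1, (b, w'))]).

Fixpoint word_deg (b : word) (d : int) : Prop :=
  match b with
  | [::] => d = 0
  | (u, m) :: b' => exists k : nat, proj k u = u /\ word_deg b' (d - (k%:Z - m - 1))
  end.

Definition rel1 (g : fcomb) : Prop :=
  exists (k : nat) (u : V) (m : int) (b : word) (w : M) (d : int),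
    [/\ proj k u = u, word_deg b d, (k%:Z - m - 1 + d < 0)%R &
        g = [:: (1, ((u, m) :: b, w))]].

(* generators (2):  o_t(u) w - rho(u + O(V)) w,  u homogeneous of weight k
   (the general case follows by linearity of o_t) *)
Definition rel2 (g : fcomb) : Prop :=
  exists (k : nat) (u : V) (w : M),
    proj k u = u /\ g = [:: (1, ([:: (u, k%:Z - 1)], w)); (-1, ([::], rho u w))].

Definition rel3 (g : fcomb) : Prop :=
  exists (ku kv : nat) (u v : V) (p q : int) (b : word) (w : M) (d : int),
    [/\ proj ku u = u, proj kv v = v, word_deg b d,
        (kv%:Z + d > q)%R /\ (0 <= ku%:Z - p - 1 + kv%:Z - q - 1 + d)%R &
        g = (1, ((u, p) :: (v, q) :: b, w)) ::
            [seq (- (binz (p - ku%:Z - d) ij.1 * binz (ku%:Z + d) ij.2),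
                  ((mode u (p - ku%:Z - d - ij.1%:Z + ij.2%:Z) v,
                    q + ku%:Z + d + ij.1%:Z - ij.2%:Z) :: b, w))
            | ij <- [seq (i, j) | i <- iota 0 (nrange (kv%:Z + d - q - 1)),
                                  j <- iota 0 (nrange (ku%:Z + d))]]].

Definition I_gen (g : fcomb) : Prop :=
  [\/ multilin_rel g, rel1 g, rel2 g | rel3 g].

(* s represents an element of I (i.e. s = 0 in S_1(M)) *)
Definition in_I (s : fcomb) : Prop := in_submod I_gen s.

(* generators of J (lifted to T(V[t,t^-1]) (x) M; homogeneous elements of
   S_1(M) lift to homogeneous elements since I is graded):
   sum_{j=0}^{wt u + deg w} C(wt u + deg w, j) (u_{p-i-j} v)(q+i+j) w *)
Definition J_gen (g : fcomb) : Prop :=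
  exists (ku kv : nat) (u v : V) (p q i : int) (b : word) (w : M) (d : int),
    [/\ proj ku u = u, proj kv v = v, word_deg b d,
        (kv%:Z + d - q <= i)%R &
        g = [seq (binz (ku%:Z + d) j,
                  ((mode u (p - i - j%:Z) v, q + i + j%:Z) :: b, w))
            | j <- iota 0 (nrange (ku%:Z + d))]].

(* the class of s in S_1(M) lies in J *)
Definition in_J (s : fcomb) : Prop := in_submod (fun g => I_gen g \/ J_gen g) s.

End VA.

(* Main.v *)
(** A linear map from T(V[t,t^-1]) (x) M to M is constructed that is the identity
    on M and kills all generators of I and J; this forces J and M to meet in 0.

    For [e : int] let u[e] be the sum over k of (proj k u)(k - 1 - e), the mode of
    degree e. The bracket [u[e], v[f]] = (br e u v)[e + f], which is independent of
    f, makes the modes a graded Leibniz algebra g acting on T(g_+) (x) M: raising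
    modes multiply, the others are commuted to the right, and on M negative degrees
    act by 0 and degree 0 acts by rho. The map sought sends a word applied to w
    to the M-component of the result.

    Everything is phrased through functionals on T(g_+) (x) M, precomposition with
    a mode being [act]. Antisymmetry and commutation of raising modes fail in
    T(g_+) (x) M, but hold under every functional obtained from the projection to M
    by repeated [act]. The same is true of the associativity relation [defect = 0]:
    on M it is the two-point computation, where O(V) and the product of A(V) enter,
    and commutation with modes propagates it. The generators (3) and those of J are
    consequences of associativity. *)
Require Import Defs.
From HB Require Import structures.
From mathcomp Require Import all_boot all_order all_algebra.
From mathcomp Require Import zify ring.
From mathcomp Require Import complex reals boolp.
Set Implicit Arguments. Unset Strict Implicit. Unset Printing Implicit Defensive.
Import Order.TTheory GRing.Theory Num.Theory.
Local Open Scope ring_scope.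

(** * Binomial coefficients with integer upper index, and rearrangements of finite sums *)

Section Binomials.
Variable K : numFieldType.
Local Notation bin := (binz K).

Lemma binz0 n : bin n 0 = 1.
Proof. by rewrite /binz big_ord0 fact0 divr1. Qed.

Lemma binzS n i :
  bin n i.+1 = bin n i * (n%:~R - i%:R) / i.+1%:R.
Proof.
rewrite /binz big_ord_recr /= factS natrM.
have h1 : (i`!)%:R != 0 :> K by rewrite pnatr_eq0 -lt0n fact_gt0.
have h2 : i.+1%:R != 0 :> K by rewrite pnatr_eq0.
move: h1 h2; move: (i`!)%:R (i.+1%:R : K) => a b h1 h2.
by field; rewrite h1 h2.
Qed.

Lemma binz_pascal n i : bin (n + 1) i.+1 = bin n i.+1 + bin n i.
Proof.
have h1 : (i`!)%:R != 0 :> K by rewrite pnatr_eq0 -lt0n fact_gt0.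
have h2 : i.+1%:R != 0 :> K by rewrite pnatr_eq0.
rewrite [bin n i.+1]binzS {1}/binz big_ord_recl /= factS natrM.
have -> : \prod_(j < i) ((n + 1)%:~R - (lift ord0 j)%:R) =
          \prod_(j < i) (n%:~R - j%:R) :> K.
  by apply: eq_bigr => j _; rewrite lift0 intrD -natr1; ring.
rewrite /binz intrD; move: h2; rewrite -natr1.
move: h1; move: (i`!)%:R (i%:R : K) => a b h1 h2.
by field; rewrite h1 h2.
Qed.

Lemma binz0n i : bin 0 i = (i == 0)%:R.
Proof.
case: i => [|i]; first by rewrite binz0.
by rewrite /binz big_ord_recl /= subrr mul0r mul0r.
Qed.

Lemma binz_nat (n i : nat) : bin n i = 'C(n, i)%:R.
Proof.
elim: n i => [|n IHn] [|i]; rewrite ?binz0 ?bin0 //; first by rewrite binz0n.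
by rewrite -addn1 PoszD binz_pascal !IHn addn1 binS natrD.
Qed.

Lemma binzN1 i : bin (-1) i = (-1) ^+ i.
Proof.
elim: i => [|i IHi]; first by rewrite binz0.
by move: (binz_pascal (-1) i); rewrite addNr binz0n IHi exprS /= => /eqP;
  rewrite eq_sym addr_eq0 => /eqP ->; ring.
Qed.

Lemma int_ind1 (P : int -> Prop) :
  P 0 -> (forall n, P n -> P (n + 1)) -> (forall n, P (n + 1) -> P n) ->
  forall n, P n.
Proof.
move=> P0 Pup Pdown; elim/int_ind => // n Pn.
  by rewrite -addn1 PoszD; apply: Pup.
by apply: Pdown; rewrite (_ : _ + 1 = - n%:Z)//; lia.
Qed.

(** By Pascal's rule and the case of smaller [t], passing from [m] to [m + 1] changes both sides by
    the same amount. The step runs in both directions, which covers negative [m]. *)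
Lemma binz_vandermonde m n t :
  bin (m + n) t = \sum_(i < t.+1) bin m i * bin n (t - i).
Proof.
elim: t m n => [|t IHt] m n.
  by rewrite big_ord_recr big_ord0 /= !binz0; ring.
have step (p : int) : \sum_(i < t.+2) bin (p + 1) i * bin n (t.+1 - i) =
    \sum_(i < t.+2) bin p i * bin n (t.+1 - i) + bin (p + n) t.
  rewrite IHt !(big_ord_recl t.+1) /= !binz0 -addrA; congr (_ + _).
  rewrite -big_split /=; apply: eq_bigr => i _.
  by rewrite /bump /= add1n binz_pascal subSS; ring.
elim/int_ind1: m => [|m IHm|m IHm].
- rewrite add0r big_ord_recl binz0 mul1r subn0 big1 ?addr0// => i _.
  by rewrite binz0n lift0 mul0r.
- by rewrite step -IHm addrAC binz_pascal.
- by move: IHm; rewrite step addrAC binz_pascal => /addIr.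
Qed.

Lemma binz_trinomial m (i s : nat) :
  bin m (i + s) * 'C(i + s, i)%:R = bin m i * bin (m - i%:Z) s.
Proof.
have h j : (j`!)%:R != 0 :> K by rewrite pnatr_eq0 -lt0n fact_gt0.
rewrite /binz big_split_ord /=.
have -> : \prod_(j < s) (m%:~R - (i + j)%:R) =
          \prod_(j < s) ((m - i%:Z)%:~R - j%:R) :> K.
  by apply: eq_bigr => j _; rewrite natrD intrB; ring.
rewrite -(bin_fact (leq_addr s i)) addKn !natrM.
have hC : 'C(i + s, i)%:R != 0 :> K by rewrite pnatr_eq0 -lt0n bin_gt0 leq_addr.
by field; rewrite hC !h.
Qed.

(** Coefficient of x^t in (1+x)^(p+q) (1 - x/(1+x))^p = (1+x)^q. It encodes the substitution x ->
    -x/(1+x) that comes with skew-symmetry under [rho]. *)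
Lemma binz_alt_convolution p q t :
  \sum_(s < t.+1) (-1) ^+ s * bin p s * bin (p + q - s%:Z) (t - s) = bin q t.
Proof.
(* Replacing [p + q] by an independent [r] lets [p] vary alone in the induction. *)
suff H (r : int) : \sum_(s < t.+1) (-1) ^+ s * bin p s * bin (r - s%:Z) (t - s) =
    bin (r - p) t by rewrite H addrAC subrr add0r.
elim: t p r {q} => [|t IHt] p r.
  by rewrite big_ord_recr big_ord0 /= !binz0; ring.
have step (p' : int) : \sum_(s < t.+2) (-1) ^+ s * bin (p' + 1) s * bin (r - s%:Z) (t.+1 - s) =
    \sum_(s < t.+2) (-1) ^+ s * bin p' s * bin (r - s%:Z) (t.+1 - s)
      - bin (r - 1 - p') t.
  rewrite -IHt !(big_ord_recl t.+1) /= !binz0 -addrA; congr (_ + _).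
  rewrite -sumrB; apply: eq_bigr => i _.
  rewrite /bump /= add1n binz_pascal subSS exprS.
  rewrite (_ : r - 1 - i%:Z = r - i.+1%:Z); last by lia.
  by ring.
have pas (p' : int) : bin (r - p') t.+1 = bin (r - (p' + 1)) t.+1 + bin (r - 1 - p') t.
  rewrite (_ : r - p' = r - 1 - p' + 1); last by lia.
  by rewrite binz_pascal (_ : r - (p' + 1) = r - 1 - p'); last by lia.
elim/int_ind1: p => [|p IHp|p IHp].
- rewrite big_ord_recl big1 => [|i _]; last by rewrite binz0n lift0 mulr0 mul0r.
  rewrite binz0 addr0 subr0 subn0 /=. by ring.
- by rewrite step IHp pas addrK.
- by rewrite pas -IHp step subrK.
Qed.

(** Coefficient of x^s in (1+x)^n ((1+x) - 1)^l = x^l (1+x)^n. *)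
Lemma bin_difference (l : nat) n s :
  \sum_(i < l.+1) (-1) ^+ i * 'C(l, i)%:R * bin (n + l%:Z - i%:Z) s =
  if (l <= s)%N then bin n (s - l) else 0.
Proof.
elim: l n => [|l IHl] n.
  by rewrite big_ord1 bin0 expr0 subn0 !mul1r addr0 subr0.
have -> : \sum_(i < l.+2) (-1) ^+ i * 'C(l.+1, i)%:R * bin (n + l.+1%:Z - i%:Z) s =
    \sum_(i < l.+1) (-1) ^+ i * 'C(l, i)%:R * bin (n + 1 + l%:Z - i%:Z) s
    - \sum_(i < l.+1) (-1) ^+ i * 'C(l, i)%:R * bin (n + l%:Z - i%:Z) s.
  have -> : \sum_(i < l.+1) (-1) ^+ i * 'C(l, i)%:R * bin (n + 1 + l%:Z - i%:Z) s
      = \sum_(i < l.+2) (-1) ^+ i * 'C(l, i)%:R * bin (n + l.+1%:Z - i%:Z) s.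
    rewrite [RHS]big_ord_recr /= (bin_small (ltnSn l)) mulr0 mul0r addr0.
    by apply: eq_bigr => i _; rewrite (_ : n + 1 + l%:Z = n + l.+1%:Z)//; lia.
  rewrite !(big_ord_recl l.+1) /= !bin0 -[RHS]addrA; congr (_ + _).
  rewrite -sumrB; apply: eq_bigr => i _.
  rewrite /bump /= add1n binS natrD exprS.
  by rewrite (_ : n + l.+1%:Z - i.+1%:Z = n + l%:Z - i%:Z); [ring | lia].
rewrite !IHl; case: (ltngtP l s) => [ls|ls|<-].
- by rewrite -subnSK// binz_pascal addrAC subrr add0r.
- by rewrite subrr.
- by rewrite subnn !binz0 subrr.
Qed.

Lemma sum_signed_bin (t : nat) :
  \sum_(i < t.+1) 'C(t, i)%:R * (-1) ^+ (t - i) = (t == 0)%:R :> K.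
Proof.
have := exprDn (-1 : K) 1 t; rewrite addNr expr0n => ->.
by apply: eq_bigr => i _; rewrite expr1n mulr1 mulr_natl.
Qed.

Lemma sum_ord_truncate (U : zmodType) (f : nat -> U) (m n : nat) :
  (m <= n)%N -> (forall i, (m <= i)%N -> f i = 0) ->
  \sum_(i < n) f i = \sum_(i < m) f i.
Proof.
move=> mn f0; rewrite -(subnKC mn) big_split_ord /= [X in _ + X]big1 ?addr0// => i _.
by rewrite f0// leq_addr.
Qed.

Lemma sum_ord_shift (U : zmodType) (f : nat -> U) (m n : nat) :
  (forall i, (i < m)%N -> f i = 0) ->
  (forall i, (n <= i)%N -> f i = 0) ->
  \sum_(i < n) f i = \sum_(i < n) f (m + i)%N.
Proof.
move=> f0 f1; rewrite -(@sum_ord_truncate _ f n (m + n)) ?leq_addl//.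
by rewrite big_split_ord /= big1 ?add0r// => i _; rewrite f0.
Qed.

(** The square of indices is collected along its diagonals; those with t >= n, which it meets only
    in part, carry [Y t = 0]. *)
Lemma sum_convolution (U : lmodType K) (c : nat -> nat -> K) (Y : nat -> U) n :
  (forall t, (n <= t)%N -> Y t = 0) ->
  \sum_(i < n) \sum_(j < n) c i j *: Y (i + j)%N =
  \sum_(t < n) (\sum_(i < t.+1) c i (t - i)%N) *: Y t.
Proof.
move=> Y0; under [RHS]eq_bigr => t _ do rewrite scaler_suml.
have -> : \sum_(t < n) \sum_(i < t.+1) c i (t - i)%N *: Y t =
   \sum_(t < n) \sum_(i < n) (if (i <= t)%N then c i (t - i)%N *: Y t else 0).
  apply: eq_bigr => t _; rewrite -[RHS]big_mkcond /=.
  rewrite (big_ord_widen_cond n xpredT (fun i => c i (t - i)%N *: Y t))//.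
rewrite [RHS]exchange_big /=; apply: eq_bigr => i _.
pose f t := if (i <= t)%N then c i (t - i)%N *: Y t else 0.
transitivity (\sum_(j < n) f (i + j)%N).
  by apply: eq_bigr => j _; rewrite /f leq_addr addKn.
apply/esym/sum_ord_shift => t ht; rewrite /f; first by rewrite leqNgt ht.
by rewrite Y0// scaler0 if_same.
Qed.

End Binomials.

(** * Linear maps given as bare functions *)

Section LinearMaps.
Variables (K : numFieldType) (U W : lmodType K) (f : U -> W).
Hypothesis lin_f : linear f.

Lemma linear_map0 : f 0 = 0.
Proof.
have := lin_f (-1) 0 0; rewrite scaler0 addr0 => /eqP.
by rewrite scaleN1r addNr => /eqP.
Qed.

Lemma linear_mapD x y : f (x + y) = f x + f y.
Proof. by rewrite -{1}[x]scale1r lin_f scale1r. Qed.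

Lemma linear_mapZ a x : f (a *: x) = a *: f x.
Proof. by rewrite -[a *: x]addr0 lin_f linear_map0 addr0. Qed.

Lemma linear_map_sum I (r : seq I) (P : pred I) (F : I -> U) :
  f (\sum_(i <- r | P i) F i) = \sum_(i <- r | P i) f (F i).
Proof. exact: (big_morph f linear_mapD linear_map0). Qed.

End LinearMaps.

(** * Sums of families with finite support *)

Section FiniteSums.
Variables (K : numFieldType) (U : lmodType K).
Implicit Types f g : nat -> U.

Definition eventually0 f := exists n : nat, forall i, (n <= i)%N -> f i = 0.

(* [fsum f] is [0] when [f] does not have finite support. *)
Definition fsum f : U :=
  if pselect (eventually0 f) is left h then \sum_(i < projT1 (cid h)) f i else 0.

Lemma fsumE f n : (forall i, (n <= i)%N -> f i = 0) -> fsum f = \sum_(i < n) f i.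
Proof.
move=> f0; rewrite /fsum; case: pselect => [h|[]]; last by exists n.
case: cid => m /= fm.
rewrite -(@sum_ord_truncate _ _ m (maxn m n)) ?leq_maxl//.
by rewrite -(@sum_ord_truncate _ _ n (maxn m n)) ?leq_maxr.
Qed.

Lemma fsum_linear a f g : eventually0 f -> eventually0 g ->
  fsum (fun i => a *: f i + g i) = a *: fsum f + fsum g.
Proof.
move=> [m fm] [n gn].
have fmn i : (maxn m n <= i)%N -> f i = 0 by rewrite geq_max => /andP[/fm].
have gmn i : (maxn m n <= i)%N -> g i = 0 by rewrite geq_max => /andP[_ /gn].
rewrite (fsumE fmn) (fsumE gmn) (@fsumE _ (maxn m n)) => [|i hi].
  by rewrite scaler_sumr big_split.
by rewrite fmn// gmn// scaler0 addr0.
Qed.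

Lemma eq_fsum f g : f =1 g -> fsum f = fsum g.
Proof. by move=> /funext ->. Qed.

End FiniteSums.

(** * The products [gam] and the bracket [br] of a graded vertex algebra *)

Section GradedVertexAlgebra.
Variables (K : numFieldType) (V : lmodType K) (proj : nat -> V -> V).
Variables (mode : V -> int -> V -> V) (vac : V).
Hypothesis HV : is_Ngraded_VA proj mode vac.
Local Notation bin := (binz K).

Lemma proj_linear k : linear (proj k).
Proof. by case: HV => -[pl _ _] _ a x y; exact: pl. Qed.

Lemma mode_linearl n v : linear (fun u => mode u n v).
Proof. by case: HV => _ [h _] a x y; exact: h. Qed.

Lemma mode_linearr u n : linear (mode u n).
Proof. by case: HV => _ [_ [h _]] a x y; exact: h. Qed.

Definition homz (n : int) (u : V) := projz proj n u = u.

Lemma homz_lt0 n u : (n < 0)%R -> homz n u -> u = 0.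
Proof. by case: n => // n _; rewrite /homz => <-. Qed.

Lemma homz0 n : homz n 0.
Proof. by case: n => //= n; rewrite /homz /= (linear_map0 (proj_linear n)). Qed.

Lemma homz_proj k u : homz k%:Z (proj k u).
Proof. by rewrite /homz /=; case: HV => -[_ pp _] _; rewrite pp eqxx. Qed.

Lemma proj_homz k a u : homz a u -> proj k u = if k%:Z == a then u else 0.
Proof.
case: a => [a|a]; rewrite /homz /= => h.
  rewrite -h; case: HV => -[_ pp _] _; rewrite pp.
  by rewrite (inj_eq (fun x y (e : Posz x = Posz y) => let: erefl := e in erefl)).
by rewrite -h (linear_map0 (proj_linear k)).
Qed.

Lemma mode_homz a b u v n :
  homz a u -> homz b v -> homz (a + b - n - 1) (mode u n v).
Proof.
case: a => [a|a] hu; last first.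
  by rewrite (homz_lt0 _ hu)// (linear_map0 (mode_linearl n v)) => _; exact: homz0.
case: b => [b|b] hv; last first.
  by rewrite (homz_lt0 _ hv)// (linear_map0 (mode_linearr u n)); exact: homz0.
case: HV => _ [_ [_ [_ [_ [_ [_ h]]]]]].
by rewrite /homz h.
Qed.

Lemma mode_homz0 a b u v n :
  homz a u -> homz b v -> (a + b - n - 1 < 0)%R -> mode u n v = 0.
Proof. by move=> hu hv h; apply: homz_lt0 h (mode_homz _ hu hv). Qed.

Lemma homogeneous_ext (W : lmodType K) (f g : V -> W) : linear f -> linear g ->
  (forall a u, homz a u -> f u = g u) -> f =1 g.
Proof.
move=> lf lg fg u; case: HV => -[_ _ /(_ u)[n [_ ->]]] _.
rewrite (linear_map_sum lf) (linear_map_sum lg).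
by apply: eq_bigr => i _; apply/fg/homz_proj.
Qed.

(* For [u] homogeneous of weight [k] this is
   Res_x x^l (1+x)^(k-1-l-e) Y(u,x)v. *)
Definition gam (l e : int) (u v : V) : V :=
  fsum (fun k : nat => fsum (fun j : nat =>
    bin (k%:Z - 1 - l - e) j *: mode (proj k u) (l + j%:Z) v)).

Lemma gam_summand_eventually0 l e k u v : eventually0 (fun j : nat =>
    bin (k%:Z - 1 - l - e) j *: mode (proj k u) (l + j%:Z) v).
Proof.
case: HV => _ [_ [_ [h _]]]; have [n hn] := h (proj k u) v.
exists (absz n + absz l)%N => i hi; rewrite hn ?scaler0//; lia.
Qed.

Lemma gam_eventually0 l e u v : eventually0 (fun k : nat => fsum (fun j : nat =>
    bin (k%:Z - 1 - l - e) j *: mode (proj k u) (l + j%:Z) v)).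
Proof.
case: HV => -[_ _ /(_ u)[n [pn _]]] _; exists n => k nk.
rewrite (@fsumE _ _ _ 0%N) ?big_ord0// => j _.
by rewrite pn// (linear_map0 (mode_linearl _ _)) scaler0.
Qed.

Lemma gam_linearl l e v : linear (fun u => gam l e u v).
Proof.
move=> a x y; rewrite /gam -fsum_linear; do ?exact: gam_eventually0.
apply: eq_fsum => k; rewrite -fsum_linear; do ?exact: gam_summand_eventually0.
apply: eq_fsum => j; rewrite (proj_linear k) (mode_linearl _ v) scalerDr.
by rewrite !scalerA mulrC.
Qed.

Lemma gam_linearr l e u : linear (gam l e u).
Proof.
move=> a x y; rewrite /gam -fsum_linear; do ?exact: gam_eventually0.
apply: eq_fsum => k; rewrite -fsum_linear; do ?exact: gam_summand_eventually0.
apply: eq_fsum => j; rewrite (mode_linearr _ _) scalerDr.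
by rewrite !scalerA mulrC.
Qed.

Lemma gam_homz l e a b u v (n : nat) : homz a u -> homz b v ->
  (a + b - l - n%:Z - 1 < 0)%R ->
  gam l e u v = \sum_(j < n) bin (a - 1 - l - e) j *: mode u (l + j%:Z) v.
Proof.
move=> hu hv hn; case: (ltrP a 0) => [a0|a0].
  rewrite (homz_lt0 a0 hu) (linear_map0 (gam_linearl l e v)) big1// => i _.
  by rewrite (linear_map0 (mode_linearl _ _)) scaler0.
case: a a0 hu hn => // a _ hu hn.
pose F (k : nat) := fsum (fun j : nat =>
    bin (k%:Z - 1 - l - e) j *: mode (proj k u) (l + j%:Z) v).
have F0 k : k != a -> F k = 0.
  move=> ka; rewrite /F (@fsumE _ _ _ 0%N) ?big_ord0// => j _.
  rewrite (proj_homz _ hu) ifF ?(linear_map0 (mode_linearl _ _)) ?scaler0//.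
  by apply/negbTE; apply: contraNneq ka => -[->].
rewrite /gam (@fsumE _ _ F a.+1) => [|k ak]; last by rewrite F0// gtn_eqF.
rewrite big_ord_recr /= big1 ?add0r => [|i _]; last by rewrite F0// ltn_eqF.
rewrite /F (proj_homz _ hu) eqxx; apply: fsumE => i ni.
rewrite (mode_homz0 hu hv) ?scaler0//; lia.
Qed.

(** Lowering [e] adds a factor 1 + x to the residue: its 1 gives the first term, its x raises [l] by
    one. *)
Lemma gam_pascal l e u v :
  gam l (e - 1) u v = gam l e u v + gam (l + 1) (e - 1) u v.
Proof.
have linD x : linear (fun u => gam l e u x + gam (l + 1) (e - 1) u x).
  by move=> c y z; rewrite !(gam_linearl _ _ _ c) scalerDr addrACA.
have linDr x : linear (fun v => gam l e x v + gam (l + 1) (e - 1) x v).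
  by move=> c y z; rewrite !(gam_linearr _ _ _ c) scalerDr addrACA.
apply: (homogeneous_ext (gam_linearl l (e - 1) v) (linD v)) => a {}u hu.
apply: (homogeneous_ext (gam_linearr l (e - 1) u) (linDr u)) => b {}v hv.
 pose n := (absz a + absz b + absz l).+1.
rewrite (gam_homz (l := l + 1) (n := n) _ hu hv); last by lia.
rewrite !(gam_homz (l := l) (n := n.+1) _ hu hv); try lia.
rewrite !(big_ord_recl n) !binz0 -[RHS]addrA; congr (_ + _).
rewrite -big_split /=; apply: eq_bigr => i _.
rewrite /bump /= add1n.
rewrite (_ : a - 1 - l - (e - 1) = a - 1 - l - e + 1); last by lia.
rewrite binz_pascal scalerDl; congr (_ + _).
rewrite (_ : a - 1 - (l + 1) - (e - 1) = a - 1 - l - e); last by lia.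
by rewrite (_ : l + 1 + i%:Z = l + i.+1%:Z)//; lia.
Qed.

(** Borcherds' identity at l = 0, where [bin 0 i] leaves only i = 0 on the right. *)
Lemma mode_commutator a b c u v w m n (N : nat) :
  homz a u -> homz b v -> homz c w -> (a + b - N%:Z - 1 < 0)%R ->
  mode u m (mode v n w) = mode v n (mode u m w) +
    \sum_(i < N) bin m i *: mode (mode u i%:Z v) (m + n - i%:Z) w.
Proof.
move=> hu hv hw hN.
(* [N'] meets the vanishing conditions of [borcherds] for all three pairs; the sum is then cut back
   to [N]. *)
pose N' := (N + absz a + absz b + absz c + absz m + absz n).+1.
have {}hN' : (N <= N')%N by lia.
have u0 (i : nat) : (N <= i)%N -> mode u i%:Z v = 0.
  by move=> Ni; apply: (mode_homz0 hu hv); lia.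
have : borcherds mode u v w 0 m n by case: HV => _ [_ [_ [_ [_ [_ [h _]]]]]].
move=> /(_ N'); rewrite (@sum_ord_truncate _ (fun i => bin m i *:
    mode (mode u (0 + i%:Z) v) (m + n - i%:Z) w) N N')// => [|i Ni]; last first.
  by rewrite add0r u0// (linear_map0 (mode_linearl _ _)) scaler0.
move=> h; rewrite (_ : \sum_(i < N) _ = mode u m (mode v n w) - mode v n (mode u m w)).
  by rewrite addrC subrK.
transitivity (\sum_(i < N) bin m i *: mode (mode u (0 + i%:Z) v) (m + n - i%:Z) w).
  by apply: eq_bigr => i _; rewrite add0r.
rewrite h => [|i Ni].
  rewrite big_ord_recl big1 => [|i _]; last by rewrite binz0n mulr0 scale0r.
  by rewrite binz0 addr0 expr0 mulr1 scale1r expr0z scale1r !add0r !subr0 ?addr0.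
split; [rewrite add0r u0//; lia | apply: (mode_homz0 hv hw); lia
  | apply: (mode_homz0 hu hw); lia].
Qed.

(** At l = 0 this is sum_j C(m, j) u_j v with m = wt u - 1 - e, the coefficients in the commutator
    formula for u_m. *)
Definition br (e : int) (u v : V) := gam 0 e u v.

Lemma br_linearl e v : linear (fun u => br e u v).
Proof. exact: gam_linearl. Qed.

Lemma br_linearr e u : linear (br e u).
Proof. exact: gam_linearr. Qed.

Lemma br_homz e a b u v (n : nat) : homz a u -> homz b v ->
  (a + b - n%:Z - 1 < 0)%R ->
  br e u v = \sum_(j < n) bin (a - 1 - e) j *: mode u j%:Z v.
Proof.
move=> hu hv hn; rewrite /br (gam_homz (n := n) _ hu hv); last by lia.
by apply: eq_bigr => j _; rewrite subr0 add0r.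
Qed.

(** Bracketing with a mode of [z] is a derivation of every product [gam l e]: commuting z_s past
    u_(l+j) leaves the term in [br g z v], and the commutators resum to the term in [br g z u]. At l
    = 0 this is the Leibniz identity. *)
Lemma br_gam g l e z u v : br g z (gam l e u v) =
  gam l (e + g) (br g z u) v + gam l e u (br g z v).
Proof.
have lz u' v' : linear (fun z => gam l (e + g) (br g z u') v' + gam l e u' (br g z v')).
  move=> c x y; rewrite /br !(gam_linearl _ _ _ c) (gam_linearr _ _ _ c).
  by rewrite scalerDr addrACA.
have lu z' v' : linear (fun u => gam l (e + g) (br g z' u) v' + gam l e u (br g z' v')).
  move=> c x y; rewrite /br (gam_linearr _ _ _ c) !(gam_linearl l _ _ c).
  by rewrite scalerDr addrACA.
have lv z' u' : linear (fun v => gam l (e + g) (br g z' u') v + gam l e u' (br g z' v)).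
  by move=> c x y; rewrite /br !(gam_linearr _ _ _ c) scalerDr addrACA.
have lu' z' v' : linear (fun u => br g z' (gam l e u v')).
  by move=> c x y; rewrite /br (gam_linearl l _ _ c) (gam_linearr _ _ _ c).
have lv' z' u' : linear (fun v => br g z' (gam l e u' v)).
  by move=> c x y; rewrite /br !(gam_linearr _ _ _ c).
apply: (homogeneous_ext (gam_linearl _ _ _) (lz u v)) => c {}z hz.
apply: (homogeneous_ext (lu' z v) (lu z v)) => a {}u hu.
apply: (homogeneous_ext (lv' z u) (lv z u)) => b {}v hv {lz lu lv lu' lv'}.
pose n := (absz a + absz b + absz c + absz l).+2.
pose N := a - 1 - l - e; pose m := c - 1 - g.
pose X (i t : nat) := mode (mode z i%:Z u) (l + t%:Z) v.
have X0 i t : (n <= i + t)%N -> X i t = 0.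
  move=> h; apply: mode_homz0 (mode_homz _ hz hu) hv _; lia.
have -> : br g z (gam l e u v) = \sum_(j < n) \sum_(s < n)
    (bin N j * bin m s) *: mode z s%:Z (mode u (l + j%:Z) v).
  rewrite (gam_homz (n := n) _ hu hv); last by lia.
  rewrite (linear_map_sum (br_linearr _ _)); apply: eq_bigr => j _.
  rewrite (linear_mapZ (br_linearr _ _)) (br_homz (n := n) _ hz (mode_homz _ hu hv)); last by lia.
  by rewrite scaler_sumr; apply: eq_bigr => s _; rewrite scalerA.
have -> : gam l e u (br g z v) = \sum_(j < n) \sum_(s < n)
    (bin N j * bin m s) *: mode u (l + j%:Z) (mode z s%:Z v).
  rewrite (br_homz (n := n) _ hz hv); last by lia.
  rewrite (linear_map_sum (gam_linearr _ _ _)) exchange_big; apply: eq_bigr => s _ /=.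
  rewrite (linear_mapZ (gam_linearr _ _ _)).
  rewrite (gam_homz (n := n) _ hu (mode_homz _ hz hv)); last by lia.
  by rewrite scaler_sumr; apply: eq_bigr => j _; rewrite scalerA mulrC.
have -> : gam l (e + g) (br g z u) v = \sum_(i < n) \sum_(t < n)
    (bin m i * bin (m - i%:Z + N) t) *: X i t.
  rewrite (br_homz (n := n) _ hz hu); last by lia.
  rewrite (linear_map_sum (gam_linearl _ _ _)); apply: eq_bigr => i _ /=.
  rewrite (linear_mapZ (gam_linearl _ _ _)).
  rewrite (gam_homz (n := n) _ (mode_homz _ hz hu) hv); last by lia.
  rewrite scaler_sumr; apply: eq_bigr => t _; rewrite scalerA.
  by congr (_ * bin _ _ *: _); rewrite /m /N; lia.
transitivity (\sum_(j < n) \sum_(s < n) ((bin N j * bin m s) *: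
      mode u (l + j%:Z) (mode z s%:Z v) +
    \sum_(i < n) (bin N j * bin m s * 'C(s, i)%:R) *:
      mode (mode z i%:Z u) (s%:Z + (l + j%:Z) - i%:Z) v)).
  apply: eq_bigr => j _; apply: eq_bigr => s _.
  rewrite (mode_commutator _ _ (N := n) hz hu hv); last by lia.
  rewrite scalerDr; congr (_ + _).
  by rewrite scaler_sumr; apply: eq_bigr => i _; rewrite scalerA binz_nat.
under eq_bigr => j _ do rewrite big_split /=.
rewrite big_split /= addrC; congr (_ + _).
under eq_bigr => j _ do rewrite exchange_big /=.
rewrite exchange_big /=; apply: eq_bigr => i _.
(* After the shift s -> i + s, trinomial revision splits off [bin m i]; Vandermonde then merges the
   other two factors. *)
transitivity (\sum_(j < n) \sum_(s < n)
    (bin m i * (bin (m - i%:Z) s * bin N j)) *: X i (s + j)%N).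
  apply: eq_bigr => j _.
  pose f (s : nat) := (bin N j * bin m s * 'C(s, i)%:R) *:
      mode (mode z i%:Z u) (s%:Z + (l + j%:Z) - i%:Z) v.
  rewrite (_ : \sum_(s < n) _ = \sum_(s < n) f s)//.
  rewrite (@sum_ord_shift _ f i); first last.
  - move=> s ns; rewrite /f (mode_homz0 (mode_homz _ hz hu) hv) ?scaler0//; lia.
  - by move=> s si; rewrite /f bin_small// mulr0 scale0r.
  apply: eq_bigr => s _; rewrite /f -mulrA binz_trinomial; congr (_ *: _).
    by ring.
  by rewrite /X; congr mode; lia.
rewrite exchange_big /=.
rewrite (@sum_convolution _ _ (fun s j => bin m i * (bin (m - i%:Z) s * bin N j)) (X i)).
  by apply: eq_bigr => t _; rewrite -mulr_sumr -binz_vandermonde.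
move=> t nt; apply: X0; lia.
Qed.

End GradedVertexAlgebra.

(** * The relations of A(V) expressed through [gam] and [br] under [rho] *)

Section ZhuModule.
Variables (K : numFieldType) (V : lmodType K) (proj : nat -> V -> V).
Variables (mode : V -> int -> V -> V) (vac : V).
Hypothesis HV : is_Ngraded_VA proj mode vac.
Variables (M : lmodType K) (rho : V -> M -> M).
Hypothesis HM : is_AV_module proj mode vac rho.
Local Notation bin := (binz K).
Local Notation homz := (homz proj).
Local Notation gam := (gam proj mode).
Local Notation br := (br proj mode).

Lemma rho_linearl w : linear (fun u => rho u w).
Proof. by case: HM => h _ _ _ _ a x y; exact: h. Qed.

Lemma rho_linearr u : linear (rho u).
Proof. by case: HM => _ h _ _ _ a x y; exact: h. Qed.

Lemma bilinear_homogeneous_ext (f g : V -> V -> M) :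
  (forall v, linear (f^~ v)) -> (forall u, linear (f u)) ->
  (forall v, linear (g^~ v)) -> (forall u, linear (g u)) ->
  (forall (a b : nat) u v, homz a u -> homz b v -> f u v = g u v) ->
  forall u v, f u v = g u v.
Proof.
move=> fl fr gl gr fg u v.
apply: (homogeneous_ext HV (fl v) (gl v)) => -[a|a] {}u hu; last first.
  by rewrite (homz_lt0 _ hu)// (linear_map0 (fl v)) (linear_map0 (gl v)).
apply: (homogeneous_ext HV (fr u) (gr u)) => -[b|b] {}v hv; last first.
  by rewrite (homz_lt0 _ hv)// (linear_map0 (fr u)) (linear_map0 (gr u)).
exact: fg hu hv.
Qed.

Lemma rho_sum (n : nat) (c : 'I_n -> K) (x : 'I_n -> V) w :
  rho (\sum_(j < n) c j *: x j) w = \sum_(j < n) c j *: rho (x j) w.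
Proof.
rewrite (linear_map_sum (rho_linearl w)); apply: eq_bigr => j _ /=.
by rewrite (linear_mapZ (rho_linearl w)).
Qed.

Lemma binzN n i : bin (- n) i = (-1) ^+ i * bin (n + i%:Z - 1) i.
Proof.
rewrite /binz mulrA; congr (_ / _).
rewrite [in RHS](reindex_inj rev_ord_inj) /=.
rewrite -[X in _ ^+ X](card_ord i) -prodr_const -big_split /=.
apply: eq_bigr => j _; rewrite -[j%:R]/(j%:Z%:~R) -[(i - _)%:R]/((i - j.+1)%:Z%:~R).
by rewrite mulN1r -!intrB -mulrNz; congr (_%:~R); have := ltn_ord j; lia.
Qed.

(* (1+x)^(wt z) (sum_i rho(z_(-1-i) 1) x^i) is constant because rho kills O(V). *)
Lemma rho_mode_vac a z (i : nat) w : homz a z ->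
  rho (mode z (-1 - i%:Z) vac) w = bin (- a) i *: rho z w.
Proof.
case: a => [a|a] hz; last first.
  rewrite (homz_lt0 _ hz)// (linear_map0 (mode_linearl HV _ _)).
  by rewrite (linear_map0 (rho_linearl w)) scaler0.
have [vm1 v0] : mode z (-1) vac = z /\ forall n, (0 <= n)%R -> mode z n vac = 0.
  by case: HV => _ [_ [_ [_ [_ [h _]]]]].
elim/ltn_ind: i => -[_|i IHi]; first by rewrite subr0 vm1 binz0 scale1r.
pose G (j : nat) := rho (mode z (-1 - i.+1%:Z + j%:Z) vac) w.
have G0 j : (i.+2 <= j)%N -> G j = 0.
  move=> ij; rewrite /G v0 ?(linear_map0 (rho_linearl w))//; lia.
(* This is the vanishing of [rho] on O(V). The natural range j <= a may be exchanged for j < i.+2: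
   [bin a j] is 0 beyond a, and [G j] is 0 from i.+2 on by the creation property. *)
have : \sum_(j < i.+2) bin a j *: G j = 0.
  pose f (j : nat) := bin a%:Z j *: G j; rewrite -[LHS]/(\sum_(j < i.+2) f j).
  have h1 := @sum_ord_truncate _ f i.+2 (maxn i.+2 a.+1) (leq_maxl _ _).
  have h2 := @sum_ord_truncate _ f a.+1 (maxn i.+2 a.+1) (leq_maxr _ _).
  rewrite -h1; last by move=> j /G0; rewrite /f => ->; rewrite scaler0.
  rewrite h2; last by move=> j aj; rewrite /f binz_nat bin_small ?scale0r.
  case: HM => _ _ /(_ a (-1 - i.+1%:Z) z vac w) h _ _.
  rewrite -[RHS]h ?lerBlDr//; last by lia.
  by rewrite /zhu_circ rho_sum; apply: eq_bigr => j _; rewrite /f binz_nat.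
(* Vandermonde for a + (-a) = 0 gives the coefficients [bin (- a)] the same recursion. *)
have /(congr1 (fun x => x *: rho z w)) := binz_vandermonde K a (- a%:Z) i.+1.
rewrite subrr binz0n scale0r scaler_suml !(big_ord_recl i.+1) /= !binz0 mul1r scale1r.
move=> /esym/eqP; rewrite addr_eq0 => /eqP -> /eqP; rewrite addr_eq0 => /eqP.
rewrite {1}/G addr0 => ->; congr (- _); apply: eq_bigr => j _.
rewrite /bump /= add1n subSS -[RHS]scalerA; congr (_ *: _).
rewrite -IHi ?ltnS ?leq_subr// /G; congr (rho (mode _ _ _) _).
by have := ltn_ord j; lia.
Qed.

(** Skew-symmetry of vertex operators, with the divided powers of the translation operator written
    as x |-> x_(-1-i) 1. Under [rho] they become scalars by [rho_mode_vac]. *)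
Lemma rho_mode_skew a b u v n (N : nat) w : homz a u -> homz b v ->
  (a + b - n - N%:Z - 1 < 0)%R ->
  rho (mode u n v) w = \sum_(j < N)
    (- (-1) ^ n * bin (a + b - n - 2) j) *: rho (mode v (n + j%:Z) u) w.
Proof.
move=> hu hv hN.
have [vv v0] : mode v (-1) vac = v /\ forall n, (0 <= n)%R -> mode v n vac = 0.
  by case: HV => _ [_ [_ [_ [_ [h _]]]]].
have [_ u0] : mode u (-1) vac = u /\ forall n, (0 <= n)%R -> mode u n vac = 0.
  by case: HV => _ [_ [_ [_ [_ [h _]]]]].
have z0 (i : nat) : (N <= i)%N -> mode v (n + i%:Z) u = 0.
  by move=> Ni; apply: (mode_homz0 HV hv hu); lia.
(* With [vac] as third argument the creation property leaves only - (-1)^n u_n v on the right. *)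
have : borcherds mode v u vac n (-1) 0 by case: HV => _ [_ [_ [_ [_ [_ [h _]]]]]].
have hN1 (i : nat) : (N.+1 <= i)%N -> [/\ mode v (n + i%:Z) u = 0,
    mode u (0 + i%:Z) vac = 0 & mode v (-1 + i%:Z) vac = 0].
  by move=> Ni; split; [apply: z0 | apply: u0 | apply: v0]; lia.
move=> /(_ N.+1 hN1).
rewrite big_ord_recr /= z0// (linear_map0 (mode_linearl HV _ _)) scaler0 addr0.
rewrite big_ord_recl [X in _ = _ + X]big1 => [|i _]; last first.
  rewrite u0 ?add0r// (v0 (-1 + _)); last by rewrite lift0; lia.
  by rewrite !(linear_map0 (mode_linearr HV _ _)) scaler0 subr0 scaler0.
rewrite !addr0 ?subr0 vv u0// (linear_map0 (mode_linearr HV _ _)) binz0 expr0 mulr1.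
rewrite scale1r sub0r => h.
have {}h : mode u n v = - (-1) ^ n *: \sum_(i < N) bin (-1) i *:
    mode (mode v (n + i%:Z) u) (-1 - i%:Z) vac.
  rewrite h scalerN scaleNr opprK scalerA -expfzMl mulrNN mulr1 exp1rz.
  by rewrite scale1r.
rewrite h scaler_sumr (linear_map_sum (rho_linearl w)); apply: eq_bigr => i _ /=.
rewrite scalerA (linear_mapZ (rho_linearl w)) (rho_mode_vac _ _ (mode_homz HV _ hv hu)).
rewrite scalerA -mulrA; congr (_ * _ *: _); rewrite binzN1 binzN mulrA -exprMn.
by rewrite mulrNN mulr1 expr1n mul1r; congr (bin _ _); lia.
Qed.

(** [rho_mode_skew] turns the left side into a double sum of modes of [v] on [u], which
    [binz_alt_convolution] contracts. *)
Lemma rho_br_skew e u v w : rho (br e u v) w = - rho (br (- e) v u) w.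
Proof.
apply: (bilinear_homogeneous_ext (f := fun u v => rho (br e u v) w)
          (g := fun u v => - rho (br (- e) v u) w)).
- by move=> v' c x y; rewrite (br_linearl HV e v' c) (rho_linearl w c).
- by move=> v' c x y; rewrite (br_linearr HV e v' c) (rho_linearl w c).
- move=> v' c x y; rewrite (br_linearr HV _ v' c) (rho_linearl w c).
  by rewrite opprD scalerN.
- move=> v' c x y; rewrite (br_linearl HV _ v' c) (rho_linearl w c).
  by rewrite opprD scalerN.
move=> a b {}u {}v hu hv; pose n := (a + b).+1.
rewrite (br_homz HV (n := n) _ hu hv); last by lia.
rewrite (br_homz HV (n := n) _ hv hu); last by lia.
rewrite !rho_sum; set p := a%:Z - 1 - e; set q := b%:Z - 1 - - e.
transitivity (\sum_(s < n) \sum_(j < n) (- ((-1) ^+ s * bin p s * bin (p + q - s%:Z) j))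
    *: rho (mode v (s + j)%N%:Z u) w).
  apply: eq_bigr => s _; rewrite (rho_mode_skew (N := n) _ hu hv); last by lia.
  rewrite scaler_sumr; apply: eq_bigr => j _; rewrite scalerA; congr (_ *: _).
  rewrite -exprnP (_ : p + q - s%:Z = a%:Z + b%:Z - s%:Z - 2); last by lia.
  by ring.
rewrite (@sum_convolution _ _ (fun s j => - ((-1) ^+ s * bin p s * bin (p + q - s%:Z) j))
    (fun t => rho (mode v t%:Z u) w)) => [|t nt]; last first.
  rewrite (mode_homz0 HV hv hu) ?(linear_map0 (rho_linearl w))//; lia.
rewrite -sumrN; apply: eq_bigr => t _.
by rewrite sumrN binz_alt_convolution scaleNr.
Qed.

Lemma rho_star_homz (a b n : nat) u v w : homz a u -> homz b v -> (a + b < n)%N ->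
  rho u (rho v w) = \sum_(j < n) bin a%:Z j *: rho (mode u (j%:Z - 1) v) w.
Proof.
move=> hu hv hn; case: HM => _ _ _ /(_ a u v w hu) <- _.
rewrite /zhu_star rho_sum (@sum_ord_truncate _ (fun j : nat =>
   bin a%:Z j *: rho (mode u (j%:Z - 1) v) w) a.+1 n); last 2 first.
- by lia.
- by move=> i ai; rewrite binz_nat bin_small// scale0r.
by apply: eq_bigr => i _; rewrite binz_nat.
Qed.

(** By skew-symmetry v * u has the residue of x^(-1) (1+x)^(wt u - 1) Y(u,x)v modulo the kernel of
    [rho]. Subtracting it from u * v leaves the factor ((1+x) - 1) x^(-1) = 1, hence [br 0 u v]. *)
Lemma rho_commutator u v w : rho u (rho v w) = rho v (rho u w) + rho (br 0 u v) w.
Proof.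
apply: (bilinear_homogeneous_ext (f := fun u v => rho u (rho v w))
          (g := fun u v => rho v (rho u w) + rho (br 0 u v) w)).
- by move=> v' c x y; rewrite (rho_linearl _ c).
- by move=> v' c x y; rewrite (rho_linearl _ c) (rho_linearr _ c).
- move=> v' c x y; rewrite (br_linearl HV _ v' c) !(rho_linearl _ c) (rho_linearr _ c).
  by rewrite scalerDr addrACA.
- move=> v' c x y; rewrite (br_linearr HV _ v' c) !(rho_linearl _ c).
  by rewrite scalerDr addrACA.
move=> a b {}u {}v hu hv; pose n := (a + b).+2.
rewrite (rho_star_homz (n := n) _ hu hv); last by lia.
rewrite (rho_star_homz (n := n) _ hv hu); last by lia.
rewrite (br_homz HV (n := n.-1) _ hu hv); last by lia.
rewrite rho_sum.
have -> : \sum_(j < n) bin b%:Z j *: rho (mode v (j%:Z - 1) u) w =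
    \sum_(t < n) bin (a%:Z - 1) t *: rho (mode u (t%:Z - 1) v) w.
  transitivity (\sum_(s < n) \sum_(j < n)
     ((-1) ^+ s * bin b%:Z s * bin (b%:Z + (a%:Z - 1) - s%:Z) j)
      *: rho (mode u ((s + j)%N%:Z - 1) v) w).
    apply: eq_bigr => s _; rewrite (rho_mode_skew (N := n) _ hv hu); last by lia.
    rewrite scaler_sumr; apply: eq_bigr => j _; rewrite scalerA; congr (_ *: _).
      rewrite (_ : b%:Z + a%:Z - (s%:Z - 1) - 2 = b%:Z + (a%:Z - 1) - s%:Z); last by lia.
      rewrite expfzDr ?oppr_eq0 ?oner_eq0// -exprnP exprN1 invrN1; by ring.
    by congr (rho (mode _ _ _) _); lia.
  rewrite (@sum_convolution _ _
    (fun s j => (-1) ^+ s * bin b%:Z s * bin (b%:Z + (a%:Z - 1) - s%:Z) j)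
    (fun t => rho (mode u (t%:Z - 1) v) w)) => [|t nt]; last first.
    rewrite (mode_homz0 HV hu hv) ?(linear_map0 (rho_linearl w))//; lia.
  by apply: eq_bigr => t _; rewrite binz_alt_convolution.
rewrite !(big_ord_recl n.-1) /= !binz0 -addrA; congr (_ + _).
rewrite -big_split /=; apply: eq_bigr => t _; rewrite /bump /= add1n.
rewrite {1}(_ : a%:Z = a%:Z - 1 + 1); last by lia.
rewrite binz_pascal scalerDl; congr (_ + _).
by rewrite subr0; congr (_ *: rho (mode _ _ _) _); lia.
Qed.

(** For e = -l - 1 the exponent of 1 + x in [gam] is wt u, so this is a generator of O(V). *)
Lemma rho_gam_circ l u v w : (l <= -2)%R -> rho (gam l (- l - 1) u v) w = 0.
Proof.
move=> l2.
apply: (bilinear_homogeneous_ext (f := fun u v => rho (gam l (- l - 1) u v) w)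
          (g := fun u v => 0)).
- by move=> v' c x y; rewrite (gam_linearl HV _ _ v' c) (rho_linearl w c).
- by move=> v' c x y; rewrite (gam_linearr HV _ _ v' c) (rho_linearl w c).
- by move=> v' c x y; rewrite scaler0 addr0.
- by move=> v' c x y; rewrite scaler0 addr0.
move=> a b {}u {}v hu hv.
pose n := (a + b + absz l).+1.
rewrite (gam_homz HV (n := n) _ hu hv); last by lia.
case: HM => _ _ /(_ a l u v w hu l2) <- _ _; congr (rho _ w).
rewrite /zhu_circ (@sum_ord_truncate _ (fun j : nat =>
   bin (a%:Z - 1 - l - (- l - 1)) j *: mode u (l + j%:Z) v) a.+1 n).
- apply: eq_bigr => i _; rewrite -binz_nat; congr (bin _ _ *: _); lia.
- by lia.
move=> i ai; rewrite (_ : _ - (- l - 1) = a%:Z); last by lia.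
by rewrite binz_nat bin_small// scale0r.
Qed.

Lemma rho_gam_star u v w : rho (gam (-1) 0 u v) w = rho u (rho v w).
Proof.
apply: (bilinear_homogeneous_ext (f := fun u v => rho (gam (-1) 0 u v) w)
          (g := fun u v => rho u (rho v w))).
- by move=> v' c x y; rewrite (gam_linearl HV _ _ v' c) (rho_linearl w c).
- by move=> v' c x y; rewrite (gam_linearr HV _ _ v' c) (rho_linearl w c).
- by move=> v' c x y; rewrite (rho_linearl _ c).
- by move=> v' c x y; rewrite (rho_linearl _ c) (rho_linearr _ c).
move=> a b {}u {}v hu hv; pose n := (a + b).+1.
rewrite (gam_homz HV (n := n) _ hu hv); last by lia.
rewrite (rho_star_homz (n := n) _ hu hv); last by lia.
rewrite rho_sum; apply: eq_bigr => i _.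
by congr (bin _ _ *: rho (mode _ _ _) _); lia.
Qed.

(** Expansion of x^l = ((1+x) - 1)^l in the residue: each power of 1 + x gives a bracket. *)
Lemma rho_gam_difference (l : nat) u v w : rho (gam l (- l%:Z - 1) u v) w =
  \sum_(i < l.+1) ((-1) ^+ i * bin l i) *: rho (br (- l%:Z - 1 + i%:Z) u v) w.
Proof.
apply: (bilinear_homogeneous_ext (f := fun u v => rho (gam l (- l%:Z - 1) u v) w)
  (g := fun u v => \sum_(i < l.+1) ((-1) ^+ i * bin l i) *:
     rho (br (- l%:Z - 1 + i%:Z) u v) w)).
- by move=> v' c x y; rewrite (gam_linearl HV _ _ v' c) (rho_linearl w c).
- by move=> v' c x y; rewrite (gam_linearr HV _ _ v' c) (rho_linearl w c).
- move=> v' c x y; rewrite scaler_sumr -big_split /=; apply: eq_bigr => i _.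
  by rewrite (br_linearl HV _ v' c) (rho_linearl w c) scalerDr !scalerA [c * _]mulrC.
- move=> v' c x y; rewrite scaler_sumr -big_split /=; apply: eq_bigr => i _.
  by rewrite (br_linearr HV _ v' c) (rho_linearl w c) scalerDr !scalerA [c * _]mulrC.
move=> a b {}u {}v hu hv; pose n := (a + b).+1.
rewrite (gam_homz HV (n := n) _ hu hv) ?rho_sum; last by lia.
transitivity (\sum_(s < n) (if (l <= s)%N then bin a%:Z (s - l) else 0) *:
    rho (mode u s%:Z v) w).
  pose f s := (if (l <= s)%N then bin a%:Z (s - l) else 0) *: rho (mode u s%:Z v) w.
  rewrite -[RHS]/(\sum_(s < n) f s) (@sum_ord_shift _ f l).
  - apply: eq_bigr => j _; rewrite /f leq_addr addKn.
    by congr (bin _ _ *: rho (mode _ _ _) _); lia.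
  - by move=> i il; rewrite /f leqNgt il /= scale0r.
  - move=> i il; rewrite /f (mode_homz0 HV hu hv) ?(linear_map0 (rho_linearl w)) ?scaler0//.
    lia.
transitivity (\sum_(i < l.+1) \sum_(s < n)
    ((-1) ^+ i * 'C(l, i)%:R * bin (a%:Z + l%:Z - i%:Z) s) *: rho (mode u s%:Z v) w).
  rewrite exchange_big; apply: eq_bigr => s _ /=.
  by rewrite -scaler_suml bin_difference.
apply: eq_bigr => i _; rewrite (br_homz HV (n := n) _ hu hv); last by lia.
rewrite rho_sum scaler_sumr; apply: eq_bigr => s _; rewrite scalerA binz_nat.
by congr (_ * bin _ _ *: _); lia.
Qed.

End ZhuModule.

Ltac cancel_sums := rewrite -[LHS]addr0 -[RHS]addr0 -!addrA;
  repeat match goal with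
  | |- ?t + _ = _ => rewrite ?(addrCA _ t); apply: (congr1 (+%R t))
  end; by [].

(** * Modes acting on functionals: degree, commutation and antisymmetry *)

Section InducedAction.
Variables (K : numFieldType) (V : lmodType K) (proj : nat -> V -> V).
Variables (mode : V -> int -> V -> V) (vac : V).
Hypothesis HV : is_Ngraded_VA proj mode vac.
Variables (M : lmodType K) (rho : V -> M -> M).
Hypothesis HM : is_AV_module proj mode vac rho.
Local Notation bin := (binz K).
Local Notation gam := (gam proj mode).
Local Notation br := (br proj mode).

(* A block letter [(v, n)] is a raising mode of degree [n.+1]; the pair of a
   block [b] and [w : M] is an element of T(g_+) (x) M. *)
Definition block := seq (V * nat).
Definition functional := block -> M -> M.
Implicit Types (F : functional) (b c : block) (w : M).

(* [act F x e] is the functional (b, w) |-> F (x . (b, w)), for [x] the mode of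
   degree [e] given by sum_k (proj k x)(k - 1 - e). *)
Fixpoint act F (x : V) (e : int) b w {struct b} : M :=
  if e is Posz n.+1 then F ((x, n) :: b) w else
  match b with
  | [::] => if e == 0 then F [::] (rho x w) else 0
  | y :: b' => act (fun c => F (y :: c)) x e b' w
               + act F (br e x y.1) (e + y.2.+1%:Z) b' w
  end.

Arguments act : simpl never.

Lemma act_pos F x n : act F x n.+1%:Z = fun b w => F ((x, n) :: b) w.
Proof. by apply/funext => b; apply/funext => w; case: b. Qed.

Lemma act_nil F x e w : (e <= 0)%R ->
  act F x e [::] w = if e == 0 then F [::] (rho x w) else 0.
Proof. by case: e => [[|n]|n]. Qed.

Lemma act_cons F x e y b w : (e <= 0)%R -> act F x e (y :: b) w =
  act (fun c => F (y :: c)) x e b w + act F (br e x y.1) (e + y.2.+1%:Z) b w.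
Proof. by case: e => [[|n]|n]. Qed.

Lemma act_lin a F F' x e b w :
  act (fun b w => a *: F b w + F' b w) x e b w = a *: act F x e b w + act F' x e b w.
Proof.
elim: b F F' x e => [|y b IHb] F F' x e; (case: (lerP e 0) => he;
  last by case: e he => [[|n]|n] // _; rewrite !act_pos).
  by rewrite !act_nil//; case: eqP; rewrite // scaler0 addr0.
by rewrite !act_cons// !IHb scalerDr addrACA.
Qed.

Lemma act_add F F' x e b w :
  act (fun b w => F b w + F' b w) x e b w = act F x e b w + act F' x e b w.
Proof.
rewrite -[act F x e b w]scale1r -act_lin; congr (act _ _ _ _ _).
by apply/funext => c; apply/funext => v; rewrite scale1r.
Qed.

Lemma eq_act F F' x e b w : (forall b w, F b w = F' b w) ->
  act F x e b w = act F' x e b w.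
Proof.
by move=> FF'; congr (act _ _ _ _ _); apply/funext => c; apply/funext => v.
Qed.

Definition bdeg b : nat := sumn [seq y.2.+1 | y <- b].

Lemma bdeg_cons y b : bdeg (y :: b) = (y.2.+1 + bdeg b)%N.
Proof. by []. Qed.

(** A mode of degree [e] shifts the degree of blocks by [e]. For d < 0 the condition on [F] is
    vacuous, so modes leading below degree 0 act by zero. *)
Lemma act_vanish F (d : int) x e b w :
  (forall b w, (bdeg b)%:Z = d -> F b w = 0) -> (bdeg b)%:Z + e = d ->
  act F x e b w = 0.
Proof.
elim: b F d x e => [|y b IHb] F d x e F0 hd; (case: (lerP e 0) => he; last first);
  try by case: e he hd => [[|n]|n] // _ hd; rewrite act_pos F0// bdeg_cons /=; lia.
- by rewrite act_nil//; case: eqP => // e0; apply: F0; rewrite -hd e0 addr0.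
- rewrite bdeg_cons in hd; rewrite act_cons// (IHb _ (d - y.2.+1%:Z)) ?add0r; last by lia.
    by apply: (IHb _ d) => //; lia.
  by move=> b' w' h; apply: F0; rewrite bdeg_cons; lia.
Qed.

Lemma act0 x e b w : act (fun _ _ => 0) x e b w = 0.
Proof. exact: (@act_vanish _ ((bdeg b)%:Z + e)). Qed.

Definition multilinear F :=
  (forall c n b w, linear (fun u => F (c ++ (u, n) :: b) w)) /\
  (forall b, linear (F b)).

Definition after F c : functional := fun b => F (c ++ b).

Lemma multilinear_after F c : multilinear F -> multilinear (after F c).
Proof.
move=> [F1 F2]; split=> [c' n b w a x y|b a x y]; rewrite /after.
  by rewrite !catA F1.
exact: F2.
Qed.

Lemma act_linear_letter F e b w : multilinear F -> linear (fun x => act F x e b w).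
Proof.
elim: b F e => [|y b IHb] F e mF a x x'; (case: (lerP e 0) => he; last first);
  try by case: e he => [[|n]|n] // _; rewrite !act_pos; exact: (mF.1 [::]).
  rewrite !act_nil//; case: eqP => _; last by rewrite scaler0 addr0.
  by rewrite (rho_linearl HM w a) mF.2.
rewrite !act_cons// (IHb _ _ (multilinear_after [:: y] mF)).
rewrite (br_linearl HV _ _ a) (IHb _ _ mF) scalerDr addrACA.
by [].
Qed.

Lemma act_linear_vector F x e b : multilinear F -> linear (act F x e b).
Proof.
elim: b F x e => [|y b IHb] F x e mF a w w'; (case: (lerP e 0) => he; last first);
  try by case: e he => [[|n]|n] // _; rewrite !act_pos; exact: mF.2.
  rewrite !act_nil//; case: eqP => _; last by rewrite scaler0 addr0.
  by rewrite (rho_linearr HM x a) mF.2.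
rewrite !act_cons// (IHb _ _ _ (multilinear_after [:: y] mF)).
by rewrite (IHb _ _ _ mF) scalerDr addrACA.
Qed.

Lemma multilinear_act F x e : multilinear F -> multilinear (act F x e).
Proof.
move=> mF; split; last by move=> b; exact: act_linear_vector.
move=> c; elim: c F x e mF => [|y c IHc] F x e mF n b w a u u' /=;
  (case: (lerP e 0) => he; last first).
- by case: e he => [[|m]|m] // _; rewrite !act_pos; exact: (mF.1 [:: (x, m)]).
- rewrite !act_cons//= (br_linearr HV _ _ a) (act_linear_letter _ _ _ mF).
  rewrite (@eq_act _ (fun b w => a *: F ((u, n) :: b) w + F ((u', n) :: b) w)).
    by rewrite act_lin scalerDr addrACA.
  by move=> b' w'; exact: (mF.1 [::]).
- by case: e he => [[|m]|m] // _; rewrite !act_pos; exact: (mF.1 [:: (x, m), y & c]).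
- rewrite !act_cons// (IHc _ _ _ (multilinear_after [:: y] mF)) (IHc _ _ _ mF).
  by rewrite scalerDr addrACA.
Qed.

Lemma br_leibniz g e x y z :
  br g x (br e y z) = br (g + e) (br g x y) z + br e y (br g x z).
Proof. by rewrite {2 4}/br (br_gam HV) [e + g]addrC. Qed.

(** [act (act F x g) y e] evaluates [F] on x.y.b, so this reads xy = yx + [x, y]. For raising [y] it
    is the recursion of [act]; otherwise both modes pass the first letter, double brackets match by
    Leibniz, and on M [rho_commutator] remains. *)
Lemma act_commute_nonraising F x g y e b w : multilinear F -> (g <= 0)%R ->
  act (act F x g) y e b w =
  act (act F y e) x g b w + act F (br g x y) (g + e) b w.
Proof.
elim: b F x g y e => [|z b IHb] F x g y e mF hg;
  (case: (lerP e 0) => he; last first);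
  try by case: e he => [[|m]|m] // _; rewrite !act_pos act_cons.
- rewrite !act_nil//; last by lia.
  case: (eqVneq e 0) => [->|e0].
    rewrite addr0; case: eqP => [g0|_]; last by rewrite addr0.
    by rewrite g0 (rho_commutator HV HM) (linear_mapD (mF.2 _)).
  rewrite (_ : (g + e == 0) = false); last by apply/eqP; lia.
  by rewrite if_same addr0.
have mFz := multilinear_after [:: z] mF.
rewrite !(act_cons _ _ _ _ _ he) !(act_cons _ _ _ _ _ hg) act_cons; last by lia.
rewrite (@eq_act (fun c => act F x g (z :: c)) (fun b w =>
   act (after F [:: z]) x g b w + act F (br g x z.1) (g + z.2.+1%:Z) b w)); last first.
  by move=> *; rewrite act_cons.
rewrite (@eq_act (fun c => act F y e (z :: c)) (fun b w =>
   act (after F [:: z]) y e b w + act F (br e y z.1) (e + z.2.+1%:Z) b w)); last first.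
  by move=> *; rewrite act_cons.
rewrite !act_add (IHb _ x g y e mFz hg) (IHb _ x g (br e y z.1) _ mF hg).
rewrite (IHb _ y e (br g x z.1) _ mF he) br_leibniz.
rewrite (linear_mapD (act_linear_letter _ _ _ mF)).
rewrite (_ : g + (e + z.2.+1%:Z) = g + e + z.2.+1%:Z); last by lia.
rewrite (_ : e + (g + z.2.+1%:Z) = g + e + z.2.+1%:Z); last by lia.
move: (act (act (after F [:: z]) y e) x g b w) (act (after F [:: z]) _ _ b w).
move: (act (act F (br g x z.1) _) y e b w) (act (act F (br e y z.1) _) x g b w).
move: (act F _ _ b w) (act F _ _ b w) => p q r s t u.
cancel_sums.
Qed.

(** In a left Leibniz algebra [x,y] + [y,x] acts by zero from the left, since [x,y] and [y,x] act by
    opposite commutators. *)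
Lemma br_skew_bracket0 e u f v z : br (e + f) (br e u v + br f v u) z = 0.
Proof.
have hX : br (e + f) (br e u v) z = br e u (br f v z) - br f v (br e u z).
  by rewrite br_leibniz addrK.
have hY : br (e + f) (br f v u) z = br f v (br e u z) - br e u (br f v z).
  by rewrite br_leibniz [f + e]addrC addrK.
by rewrite (linear_mapD (br_linearl HV _ _)) hX hY addrA subrK subrr.
Qed.

(** By [br_skew_bracket0] the symmetrized bracket passes every letter freely, and it dies on M by
    [rho_br_skew]. *)
Lemma act_skew_nonraising F e u f v b w : multilinear F -> (e + f <= 0)%R ->
  act F (br e u v + br f v u) (e + f) b w = 0.
Proof.
move=> mF hef; elim: b F mF => [|z b IHb] F mF.
  rewrite act_nil//; case: eqP => // ef; rewrite (linear_mapD (rho_linearl HM _)).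
  rewrite (rho_br_skew HV HM) (_ : - e = f); last by lia.
  by rewrite addNr (linear_map0 (mF.2 _)).
rewrite act_cons// br_skew_bracket0 (linear_map0 (act_linear_letter _ _ _ mF)).
by rewrite (IHb _ (multilinear_after [:: z] mF)) addr0.
Qed.

(** The prefix [c] makes the condition stable under prepending letters. Letters [n] and [m] have
    degrees n+1 and m+1, so their bracket is stored with index (n+m)+1. *)
Definition respects_commutators F := forall c u n v m b w,
  F (c ++ [:: (u, n), (v, m) & b]) w =
  F (c ++ [:: (v, m), (u, n) & b]) w + F (c ++ (br n.+1 u v, (n + m).+1) :: b) w.

Definition respects_skew F := forall c e u f v n b w,
  e + f = n.+1%:Z -> F (c ++ (br e u v + br f v u, n) :: b) w = 0.

Lemma act_skew F e u f v b w : multilinear F -> respects_skew F ->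
  act F (br e u v + br f v u) (e + f) b w = 0.
Proof.
move=> mF sF; case: (lerP (e + f) 0) => [|]; first exact: act_skew_nonraising.
by case E : (e + f) => [[|n]|n]// _; rewrite act_pos (sF [::]).
Qed.

(** If only [x] raises, the nonraising case with the roles exchanged applies and [act_skew] reverses
    the bracket; if both raise, this is the hypothesis on [F]. *)
Lemma act_commute F x g y e b w : multilinear F ->
  respects_commutators F -> respects_skew F ->
  act (act F x g) y e b w =
  act (act F y e) x g b w + act F (br g x y) (g + e) b w.
Proof.
move=> mF cF sF; case: (lerP g 0) => hg; first exact: act_commute_nonraising.
case: (lerP e 0) => he.
  have /eqP := act_skew e y g x b w mF sF.
  rewrite (linear_mapD (act_linear_letter _ _ _ mF)) addr_eq0 => /eqP h.
  rewrite (@act_commute_nonraising F y e)// h [e + g]addrC subrK.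
  by [].
case: g hg => [[|n]|n]// _; case: e he => [[|m]|m]// _.
rewrite (_ : n.+1%:Z + m.+1%:Z = (n + m).+2%:Z); last by lia.
by rewrite !act_pos (cF [::]).
Qed.

Lemma respects_skew_act F x g : multilinear F -> respects_skew F ->
  respects_skew (act F x g).
Proof.
move=> mF sF c; elim: c F x g mF sF => [|y c IHc] F x g mF sF e u f v n b w h;
  (case: (lerP g 0) => hg; last first).
- by case: g hg => [[|m]|m] // _; rewrite act_pos; exact: (sF [:: (x, m)] _ _ _ _ _ _ _ h).
- rewrite /= act_cons//= (@eq_act _ (fun _ _ => 0)) => [|b' w']; last exact: (sF [::]).
  rewrite act0 add0r (linear_mapD (br_linearr HV _ _)).
  (* The four Leibniz terms regroup into two symmetrized brackets, of [x,u] with v and of [x,v] with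
     u. *)
  rewrite (br_leibniz g e x u v) (br_leibniz g f x v u) [X in _ + X]addrC addrACA.
  rewrite (linear_mapD (act_linear_letter _ _ _ mF)) -h addrA.
  rewrite (act_skew (g + e) (br g x u) f v _ _ mF sF) add0r addrAC.
  by rewrite [_ + br (g + f) _ _]addrC (act_skew (g + f) (br g x v) e u _ _ mF sF).
- case: g hg => [[|m]|m] // _; rewrite act_pos.
  exact: (sF [:: (x, m), y & c] _ _ _ _ _ _ _ h).
- rewrite /= act_cons// (IHc _ x g (multilinear_after [:: y] mF) _ e u f v n)//.
    by rewrite (IHc _ _ _ mF sF e u f v n)// addr0.
  by move=> c'; exact: (sF (y :: c')).
Qed.

Lemma respects_commutators_act F x g : multilinear F ->
  respects_commutators F -> respects_skew F -> respects_commutators (act F x g).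
Proof.
move=> mF cF sF c; elim: c F x g mF cF sF => [|y c IHc] F x g mF cF sF u n v m b w;
  (case: (lerP g 0) => hg; last first).
- by case: g hg => [[|k]|k] // _; rewrite !act_pos; exact: (cF [:: (x, k)]).
(* [E] rereads a letter as a raising mode, so that [act_commute] exchanges it with a bracket
   involving [x]. *)
- have E F' x' k b' w' : F' ((x', k) :: b') w' = act F' x' k.+1%:Z b' w' by rewrite act_pos.
  rewrite /= !(act_cons _ _ _ _ _ hg) /=.
  have H : forall b w, F [:: (u, n), (v, m) & b] w =
     F [:: (v, m), (u, n) & b] w + F ((br n.+1 u v, (n + m).+1) :: b) w.
    by move=> b' w'; exact: (cF [::]).
  rewrite (eq_act _ _ _ _ H) act_add !(E (act _ _ _)).
  rewrite -[fun c => F ((u, n) :: c)]act_pos -[fun c => F ((v, m) :: c)]act_pos.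
  have C := fun x g y e => act_commute x g y e b w mF cF sF.
  rewrite [act (act F (br g x u) _) v _ b w]C.
  rewrite [act (act F u _) (br g x v) _ b w]C.
  rewrite (br_leibniz g n.+1%:Z x u v) (linear_mapD (act_linear_letter _ _ _ mF)).
  rewrite (_ : g + n.+1%:Z + m.+1%:Z = g + (n + m).+2%:Z); last by lia.
  rewrite (_ : n.+1%:Z + (g + m.+1%:Z) = g + (n + m).+2%:Z); last by lia.
  cancel_sums.
- by case: g hg => [[|k]|k] // _; rewrite !act_pos; exact: (cF [:: (x, k), y & c]).
- rewrite /= !(act_cons _ _ _ _ _ hg).
  rewrite (IHc _ x g (multilinear_after [:: y] mF)) => [|c'|c'].
  + by rewrite (IHc _ _ _ mF cF sF) addrACA.
  + exact: (cF (y :: c')).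
  + exact: (sF (y :: c')).
Qed.

End InducedAction.

Arguments act : simpl never.

(** * Associativity: first on M, then on all blocks *)

Section Associativity.
Variables (K : numFieldType) (V : lmodType K) (proj : nat -> V -> V).
Variables (mode : V -> int -> V -> V) (vac : V).
Hypothesis HV : is_Ngraded_VA proj mode vac.
Variables (M : lmodType K) (rho : V -> M -> M).
Hypothesis HM : is_AV_module proj mode vac rho.
Local Notation bin := (binz K).
Local Notation gam := (gam proj mode).
Local Notation br := (br proj mode).
Local Notation act := (act proj mode rho).
Local Notation functional := (functional V M).
Local Notation block := (block V).
Implicit Types (F : functional) (b c : block) (w : M).

Lemma act_sum I (r : seq I) (a : I -> K) (G : I -> functional) x e b w :
  act (fun b w => \sum_(i <- r) a i *: G i b w) x e b w =
  \sum_(i <- r) a i *: act (G i) x e b w.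
Proof.
elim: r => [|i r IHr].
  rewrite big_nil (@eq_act _ _ _ _ _ _ _ (fun _ _ => 0)) ?act0// => *.
  by rewrite big_nil.
rewrite big_cons -IHr -act_lin; apply: eq_act => b' w'.
by rewrite big_cons.
Qed.

(* On elements of degree d, the vu-terms of the Jacobi identity vanish when
   [l + e + d < 0], and truncating the sum at [n] loses nothing when [f + d < n]. *)
Definition defect F (l e f : int) (n : nat) (u v : V) : functional := fun b w =>
  act F (gam l e u v) (e + f) b w
  - \sum_(i < n) ((-1) ^+ i * bin l i) *: act (act F u (e + i%:Z)) v (f - i%:Z) b w.

Lemma defect_add F F' l e f n u v b w :
  defect (fun b w => F b w + F' b w) l e f n u v b w =
  defect F l e f n u v b w + defect F' l e f n u v b w.
Proof.
rewrite /defect act_add addrACA -opprD -big_split; congr (_ - _) => /=.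
apply: eq_bigr => i _; rewrite -scalerDr -act_add; congr (_ *: _).
by apply: eq_act => b' w'; rewrite act_add.
Qed.

Lemma act_defect F l e f n u v x g b w : act (defect F l e f n u v) x g b w =
  act (act F (gam l e u v) (e + f)) x g b w - \sum_(i < n) ((-1) ^+ i * bin l i) *:
    act (act (act F u (e + i%:Z)) v (f - i%:Z)) x g b w.
Proof.
rewrite /defect -(act_sum _ (fun i : 'I_n => (-1) ^+ i * bin l i)
  (fun i => act (act F u (e + i%:Z)) v (f - i%:Z))).
rewrite [RHS]addrC -[X in _ = X + _]scaleN1r -act_lin; apply: eq_act => b' w'.
by rewrite scaleN1r addrC.
Qed.

(** Modes act on the defect as derivations: [br_gam] handles the product, commutation the two-mode
    terms. Commutation is a premise because it comes from [act_commute_nonraising] in one use and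
    from [act_commute] in the other. *)
Lemma defect_commute F l e f n u v x g b w : multilinear F ->
  (forall y h b w, act (act F x g) y h b w =
     act (act F y h) x g b w + act F (br g x y) (g + h) b w) ->
  (forall z k y h b w, act (act (act F z k) x g) y h b w =
     act (act (act F z k) y h) x g b w + act (act F z k) (br g x y) (g + h) b w) ->
  defect (act F x g) l e f n u v b w =
  act (defect F l e f n u v) x g b w + (defect F l (e + g) f n (br g x u) v b w
   + defect F l e (f + g) n u (br g x v) b w).
Proof.
move=> mF H1 H2; rewrite act_defect /defect H1 (br_gam HV).
rewrite (linear_mapD (act_linear_letter HV HM _ _ _ mF)).
rewrite (_ : g + (e + f) = e + g + f); last by lia.
rewrite (_ : e + (f + g) = e + g + f); last by lia.
set A := act _ _ _ _ _; set B := act _ _ _ _ _; set C := act _ _ _ _ _.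
have -> : \sum_(i < n) ((-1) ^+ i * bin l i) *:
     act (act (act F x g) u (e + i%:Z)) v (f - i%:Z) b w =
  \sum_(i < n) ((-1) ^+ i * bin l i) *:
    act (act (act F u (e + i%:Z)) v (f - i%:Z)) x g b w +
  (\sum_(i < n) ((-1) ^+ i * bin l i) *:
     act (act F (br g x u) (e + g + i%:Z)) v (f - i%:Z) b w +
   \sum_(i < n) ((-1) ^+ i * bin l i) *:
     act (act F u (e + i%:Z)) (br g x v) (f + g - i%:Z) b w).
  rewrite -!big_split /=; apply: eq_bigr => i _; rewrite -!scalerDr; congr (_ *: _).
  rewrite (eq_act _ _ _ _ _ _ _ (H1 u (e + i%:Z))) act_add H2.
  rewrite (_ : g + (f - i%:Z) = f + g - i%:Z); last by lia.
  rewrite (_ : g + (e + i%:Z) = e + g + i%:Z); last by lia.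
  by rewrite -addrA; congr (_ + _); rewrite addrC.
by rewrite !opprD; cancel_sums.
Qed.

Definition associative_on_M F := forall c l e f n u v w,
  (l + e < 0)%R -> (f < n%:Z)%R -> defect (after F c) l e f n u v [::] w = 0.

Lemma associative_on_M_act F x g : multilinear F -> associative_on_M F ->
  associative_on_M (act F x g).
Proof.
move=> mF aF c; elim: c F x g mF aF => [|y c IHc] F x g mF aF l e f n u v w hl hf;
  (case: (lerP g 0) => hg; last first).
- by case: g hg => [[|m]|m] // _; rewrite act_pos; exact: (aF [:: (x, m)]).
- rewrite -[after _ _]/(act F x g) defect_commute//; first last.
  + by move=> *; apply: (act_commute_nonraising HV HM) => //; apply: (multilinear_act HV HM).
  + by move=> *; apply: (act_commute_nonraising HV HM).
  (* As g <= 0, the shifted indices still satisfy both inequalities. *)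
  rewrite (aF [::] l (e + g) f n)//; last by lia.
  rewrite (aF [::] l e (f + g) n)//; last by lia.
  by rewrite act_nil// (aF [::] l e f n)// if_same !addr0.
- by case: g hg => [[|m]|m] // _; rewrite act_pos; exact: (aF [:: (x, m), y & c]).
- rewrite (_ : after (act F x g) (y :: c) = (fun b w =>
    after (act (after F [:: y]) x g) c b w +
    after (act F (br g x y.1) (g + y.2.+1%:Z)) c b w)); last first.
    by apply/funext => b; apply/funext => w'; rewrite /after /= act_cons.
  rewrite defect_add (IHc _ x g (multilinear_after [:: y] mF))//.
    by rewrite add0r (IHc _ _ _ mF aF).
  by move=> c'; exact: (aF (y :: c')).
Qed.

Definition proj_M : functional := fun b w => if b is [::] then w else 0.

Lemma multilinear_proj_M : multilinear proj_M.
Proof.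
split=> [[|y c] n b w a u v|[|y b] a u v] //=; by rewrite scaler0 addr0.
Qed.

Definition two_point u v w (t : int) := act (act proj_M u t) v (- t) [::] w.

Lemma two_point_gt0 u v w t : (0 < t)%R -> two_point u v w t = 0.
Proof. by move=> t0; rewrite /two_point act_nil ?ifF//; [apply/eqP|]; lia. Qed.

Lemma two_point0 u v w : two_point u v w 0 = rho u (rho v w).
Proof. by rewrite /two_point oppr0 !act_nil. Qed.

(** Here v[-t] raises and u[t] kills M, so only their bracket, of degree 0, contributes. *)
Lemma two_point_lt0 u v w t : (t < 0)%R -> two_point u v w t = rho (br t u v) w.
Proof.
case: t => // n _; rewrite /two_point NegzE opprK act_pos act_cons//=.
rewrite act_nil; last by lia.
by rewrite -[RHS]add0r; congr (_ + _); rewrite addNr act_nil.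
Qed.

(** Induction on the distance of l + e below -1, lowered by Pascal's rule for [gam]. At l + e = -1
    the three cases l < -1, l = -1, l > -1 are O(V), the product of A(V), and a combination of
    brackets. *)
Lemma two_point_associativity (d : nat) l e n u v w :
  l + e = - d.+1%:Z -> (- e < n%:Z)%R -> rho (gam l e u v) w =
  \sum_(i < n) ((-1) ^+ i * bin l i) *: two_point u v w (e + i%:Z).
Proof.
elim: d l e n => [|d IHd] l e n hl hn.
  rewrite (_ : e = - l - 1) in hn *; last by lia.
  have [l2|l2|l2] := ltrgtP l (-1).
  - rewrite (rho_gam_circ HV HM); last by lia.
    (* Here e = -l - 1 > 0, so all two-point terms vanish too. *)
    by rewrite big1// => i _; rewrite two_point_gt0 ?scaler0//; lia.
  (* For l >= 0 the factor [bin l i] stops the sum at i = l, where the index -l - 1 + i is still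
     negative; every term is then a bracket. *)
  - case: l l2 hn {hl} => // l _ hn; rewrite (rho_gam_difference HV HM).
    pose h (i : nat) := ((-1) ^+ i * bin l i) *: two_point u v w (- l%:Z - 1 + i%:Z).
    rewrite -[RHS]/(\sum_(i < n) h i) (@sum_ord_truncate _ h l.+1); first last.
    + by move=> i il; rewrite /h binz_nat bin_small// mulr0 scale0r.
    + by lia.
    by apply: eq_bigr => i _; rewrite /h two_point_lt0//; have := ltn_ord i; lia.
  - rewrite l2 opprK subrr (rho_gam_star HV HM).
    case: n hn => [|n] hn; first by lia.
    rewrite big_ord_recl big1 => [|i _].
      by rewrite expr0 binz0 mulr1 scale1r !addr0 two_point0.
    by rewrite two_point_gt0 ?scaler0.
rewrite {1}(_ : e = e + 1 - 1); last by lia.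
rewrite (gam_pascal HV) (linear_mapD (rho_linearl HM _)).
rewrite (IHd l (e + 1) n); [|by lia..].
rewrite (IHd (l + 1) (e + 1 - 1) n); [|by lia..].
rewrite addrK; case: n hn => [|n] hn; first by rewrite !big_ord0 addr0.
rewrite [X in _ + X]big_ord_recl [RHS]big_ord_recl big_ord_recr /=.
rewrite two_point_gt0 ?scaler0 ?addr0; last by lia.
rewrite !binz0 addrCA; congr (_ + _); rewrite -big_split /=; apply: eq_bigr => i _.
rewrite /bump /= add1n binz_pascal exprS.
rewrite (_ : e + 1 + i%:Z = e + i.+1%:Z); last by lia.
by rewrite -scalerDl; congr (_ *: _); ring.
Qed.

Lemma associative_on_M_proj_M : associative_on_M proj_M.
Proof.
(* After a nonempty prefix [proj_M] is identically 0. *)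
move=> [|y c] l e f n u v w hl hf; last first.
  rewrite (_ : after _ _ = fun _ _ => 0)// /defect act0 sub0r.
  rewrite big1 ?oppr0// => i _; rewrite (@eq_act _ _ _ _ _ _ _ (fun _ _ => 0)) ?act0 ?scaler0//.
  by move=> *; rewrite act0.
rewrite -[after _ _]/proj_M /defect; have [ef|ef] := eqVneq (e + f) 0.
  apply/eqP; rewrite subr_eq0; apply/eqP; rewrite ef act_nil//=.
  rewrite (two_point_associativity (d := absz (l + e + 1)) (n := n)); last 2 first.
  - by lia.
  - by lia.
  apply: eq_bigr => i _; rewrite /two_point; congr (_ *: act _ _ _ _ _); lia.
(* In total degree e + f other than 0 there is no M-component. *)
have p0 b w' : (bdeg b)%:Z = e + f -> proj_M b w' = 0.
  by case: b => //= h; move: ef; rewrite -h.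
rewrite (act_vanish _ _ _ _ _ p0); last by rewrite add0r.
rewrite big1 ?subr0// => i _; rewrite (@act_vanish _ _ _ _ _ _ _ (f - i%:Z)) ?scaler0//.
  by move=> b w' h; apply: (act_vanish _ _ _ _ _ p0); rewrite h; lia.
by rewrite add0r.
Qed.

Definition admissible F := [/\ multilinear F, respects_commutators proj mode F,
  respects_skew proj mode F & associative_on_M F].

Lemma admissible_proj_M : admissible proj_M.
Proof.
split; [exact: multilinear_proj_M | | | exact: associative_on_M_proj_M].
- by case=> [|y c] * /=; rewrite addr0.
- by case.
Qed.

Lemma admissible_act F x g : admissible F -> admissible (act F x g).
Proof.
case=> mF cF sF aF; split.
- exact: (multilinear_act HV HM).
- exact: (respects_commutators_act HV HM).
- exact: (respects_skew_act HV HM).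
- exact: associative_on_M_act.
Qed.

(** Induction on the block: its first letter becomes a mode acting on [F], and [defect_commute]
    brings it back in front of [b]. The correction terms trade its degree for a shift of [e] or [f],
    which preserves the inequalities. *)
Lemma associativity F l e f n u v b w : admissible F ->
  (l + e + (bdeg b)%:Z < 0)%R -> (f + (bdeg b)%:Z < n%:Z)%R ->
  defect F l e f n u v b w = 0.
Proof.
elim: b F l e f n u v => [|[x m] b IHb] F l e f n u v gF hl hf.
  by case: gF => _ _ _ aF; apply: (aF [::]); move: hl hf; rewrite !addr0.
rewrite bdeg_cons /= in hl hf.
have [mF cF sF _] := gF.
have : defect (act F x m.+1%:Z) l e f n u v b w = 0.
  by apply: IHb (admissible_act _ _ gF) _ _; lia.
rewrite defect_commute//; first last.
- move=> z k *; have [mA cA sA _] := admissible_act z k gF.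
  exact: (act_commute HV HM).
- by move=> *; exact: (act_commute HV HM).
rewrite (IHb F l (e + m.+1%:Z) f)//; [|by lia..].
rewrite (IHb F l e (f + m.+1%:Z))//; [|by lia..].
by rewrite !addr0 act_pos.
Qed.

End Associativity.

(** * Evaluation of words, and its vanishing on the generators of I and J *)

Section Evaluation.
Variables (K : numFieldType) (V : lmodType K) (proj : nat -> V -> V).
Variables (mode : V -> int -> V -> V) (vac : V).
Hypothesis HV : is_Ngraded_VA proj mode vac.
Variables (M : lmodType K) (rho : V -> M -> M).
Hypothesis HM : is_AV_module proj mode vac rho.
Local Notation bin := (binz K).
Local Notation homz := (homz proj).
Local Notation gam := (gam proj mode).
Local Notation act := (act proj mode rho).
Local Notation functional := (functional V M).
Local Notation block := (block V).
Local Notation admissible := (admissible proj mode rho).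
Implicit Types (F : functional) (b c : block) (w : M) (s : word V).

Definition mode_act F (u : V) (m : int) : functional := fun b w =>
  fsum (fun k : nat => act F (proj k u) (k%:Z - 1 - m) b w).

(** With [foldl] the leftmost letter is absorbed first, so the value at [b] is [F] on s.b. *)
Definition word_act F s : functional := foldl (fun G y => mode_act G y.1 y.2) F s.

Lemma mode_act_eventually0 F u m : multilinear F ->
  exists n : nat, forall b w (k : nat), (n <= k)%N -> act F (proj k u) (k%:Z - 1 - m) b w = 0.
Proof.
move=> mF; case: HV => -[_ _ /(_ u)[n [pn _]]] _; exists n => b w k nk.
by rewrite pn// (linear_map0 (act_linear_letter HV HM _ _ _ mF)).
Qed.

Lemma mode_actE F u m : multilinear F -> exists n : nat,
  mode_act F u m = fun b w => \sum_(k < n) act F (proj k u) (k%:Z - 1 - m) b w.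
Proof.
move=> mF; have [n hn] := mode_act_eventually0 u m mF; exists n.
by apply/funext => b; apply/funext => w; apply: fsumE => k; exact: hn.
Qed.

Lemma mode_act_homz F a u m : multilinear F -> homz a u ->
  mode_act F u m = act F u (a - 1 - m).
Proof.
move=> mF hu; apply/funext => b; apply/funext => w; rewrite /mode_act.
have A0 e : act F 0 e b w = 0 by exact: (linear_map0 (act_linear_letter HV HM _ _ _ mF)).
case: a hu => [a|a] hu; last first.
  rewrite (homz_lt0 _ hu)// A0 (@fsumE _ _ _ 0%N) ?big_ord0// => k _.
  by rewrite (linear_map0 (proj_linear HV k)).
have pk k : k != a -> proj k u = 0.
  by move=> ka; rewrite (proj_homz HV _ hu) ifF//; apply/eqP => -[/eqP]; exact/negP.
rewrite (@fsumE _ _ _ a.+1) => [|k ak]; last by rewrite pk ?A0// gtn_eqF.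
rewrite big_ord_recr /= big1 ?add0r => [|k _]; last by rewrite pk ?A0// ltn_eqF.
by rewrite (proj_homz HV _ hu) eqxx.
Qed.

Lemma mode_act_linear_letter F a u u' m b w : multilinear F ->
  mode_act F (a *: u + u') m b w = a *: mode_act F u m b w + mode_act F u' m b w.
Proof.
move=> mF; rewrite /mode_act -fsum_linear.
- apply: eq_fsum => k; rewrite (proj_linear HV k a).
  by rewrite (act_linear_letter HV HM _ _ _ mF).
- by have [n hn] := mode_act_eventually0 u m mF; exists n => k; exact: hn.
- by have [n hn] := mode_act_eventually0 u' m mF; exists n => k; exact: hn.
Qed.

Lemma mode_act_linear_functional F F' a u m b w : multilinear F -> multilinear F' ->
  mode_act (fun b w => a *: F b w + F' b w) u m b w =
  a *: mode_act F u m b w + mode_act F' u m b w.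
Proof.
move=> mF mF'; rewrite /mode_act -fsum_linear.
- by apply: eq_fsum => k; rewrite act_lin.
- by have [n hn] := mode_act_eventually0 u m mF; exists n => k; exact: hn.
- by have [n hn] := mode_act_eventually0 u m mF'; exists n => k; exact: hn.
Qed.

Lemma admissible0 : admissible (fun _ _ => 0).
Proof.
split; first by split=> [c n b w|b] a x y; rewrite scaler0 addr0.
- by move=> *; rewrite addr0.
- by [].
move=> c l e f n u v w _ _; rewrite /defect act0 sub0r big1 ?oppr0// => i _.
rewrite (@eq_act _ _ _ _ _ _ _ (fun _ _ => 0)) ?act0 ?scaler0//.
by move=> *; exact: act0.
Qed.

Lemma admissible_add F F' : admissible F -> admissible F' ->
  admissible (fun b w => F b w + F' b w).
Proof.
move=> [mF cF sF aF] [mF' cF' sF' aF']; split.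
- split=> [c n b w a x y|b a x y].
    by rewrite (mF.1 c n b w a) (mF'.1 c n b w a) scalerDr addrACA.
  by rewrite (mF.2 b a) (mF'.2 b a) scalerDr addrACA.
- by move=> c u n v m b w; rewrite cF cF' addrACA.
- by move=> *; rewrite sF ?sF' ?addr0.
- move=> c l e f n u v w hl hf.
  rewrite -[after _ _]/(fun b w => after F c b w + after F' c b w) defect_add.
  by rewrite aF// aF'// addr0.
Qed.

Lemma admissible_mode_act F u m : admissible F -> admissible (mode_act F u m).
Proof.
move=> aF; have [mF _ _ _] := aF; have [n ->] := mode_actE u m mF.
elim: n => [|n IHn].
  rewrite (_ : (fun _ => _) = fun _ _ => 0); first exact: admissible0.
  by apply/funext => b; apply/funext => w; rewrite big_ord0.
rewrite (_ : (fun _ => _) = fun b w => \sum_(k < n) act F (proj k u) (k%:Z - 1 - m) b w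
   + act F (proj n u) (n%:Z - 1 - m) b w).
  by apply: admissible_add IHn _; apply: (admissible_act HV HM).
by apply/funext => b; apply/funext => w; rewrite big_ord_recr.
Qed.

Lemma admissible_word_act F s : admissible F -> admissible (word_act F s).
Proof.
elim: s F => //= -[u m] s IHs F aF; apply: IHs; exact: admissible_mode_act.
Qed.

Lemma word_act_linear_functional F F' a s b w : admissible F -> admissible F' ->
  word_act (fun b w => a *: F b w + F' b w) s b w =
  a *: word_act F s b w + word_act F' s b w.
Proof.
elim: s F F' => //= -[u m] s IHs F F' aF aF'.
have [mF _ _ _] := aF; have [mF' _ _ _] := aF'.
rewrite -IHs; [|exact: admissible_mode_act..].
rewrite (_ : mode_act _ _ _ = fun b w => a *: mode_act F u m b w + mode_act F' u m b w)//.
by apply/funext => c; apply/funext => v; rewrite mode_act_linear_functional.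
Qed.

Lemma In_mapP (T U : Type) (f : T -> U) (r : seq T) x :
  List.In x (map f r) -> exists y, x = f y.
Proof. by elim: r => //= y r IHr [<-|/IHr//]; exists y. Qed.

(** Reduces a relation applied to a homogeneous word of degree [d] to a relation on blocks of degree
    [d]: each letter shifts the degree and acts linearly on functionals. *)
Lemma word_act_vanish (r : seq (K * functional)) s (d : int) w :
  (forall x, List.In x r -> multilinear x.2) ->
  (forall b w, (bdeg b)%:Z = d -> \sum_(x <- r) x.1 *: x.2 b w = 0) ->
  word_deg proj s d -> \sum_(x <- r) x.1 *: word_act x.2 s [::] w = 0.
Proof.
elim: s r d => [|[u m] s IHs] r d mr r0 /= hs; first by apply: r0; rewrite hs.
have [k [hu hs']] := hs.
transitivity (\sum_(x <- [seq (x.1, act x.2 u (k%:Z - 1 - m)) | x <- r])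
    x.1 *: word_act x.2 s [::] w).
  rewrite big_map /=; elim: r mr {IHs r0} => [|x r IHr] mr; first by rewrite !big_nil.
  rewrite !big_cons -IHr => [|y hy]; last by apply: mr; right.
  by rewrite (@mode_act_homz x.2 k u m)//; apply: mr; left.
apply: IHs hs'.
- move=> y; elim: r mr {r0} => //= x r IHr mr [<-|].
    by apply: (multilinear_act HV HM); apply: mr; left.
  by apply: IHr => z hz; apply: mr; right.
- move=> b v hb; rewrite big_map /=.
  rewrite -(act_sum proj mode rho r (fun x => x.1) (fun x => x.2)).
  by apply: (act_vanish _ _ _ _ _ r0); lia.
Qed.

(** General [F] is needed because left multiplication by a word replaces [F] by its [word_act]. *)
Definition eval F (g : fcomb V M) : M :=
  \sum_(y <- g) y.1 *: word_act F y.2.1 [::] y.2.2.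

Lemma eval_multilin F g : admissible F -> multilin_rel g -> eval F g = 0.
Proof.
move=> aF; have [mF _ _ _] := aF.
case=> [[a [u [u' [m [s [w ->]]]]]]|[a [s [w [w' ->]]]]].
  rewrite /eval !big_cons big_nil /= addr0 !scale1r.
  rewrite (_ : mode_act F (a *: u + u') m =
      fun b w => a *: mode_act F u m b w + mode_act F u' m b w).
    rewrite word_act_linear_functional; try exact: admissible_mode_act.
    by rewrite scaleNr scaleN1r -opprD subrr.
  by apply/funext => b; apply/funext => v; exact: mode_act_linear_letter.
rewrite /eval !big_cons big_nil /= addr0 !scale1r.
have [[_ ->] _ _ _] := admissible_word_act s aF.
by rewrite scaleNr scaleN1r -opprD subrr.
Qed.

Lemma eval_rel1 F g : admissible F -> rel1 proj g -> eval F g = 0.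
Proof.
move=> aF [k [u [m [s [w [d [hu hs hd ->]]]]]]].
have [mF _ _ _] := aF.
rewrite /eval big_seq1 /=.
have := @word_act_vanish [:: (1, F)] ((u, m) :: s) (k%:Z - m - 1 + d) w.
rewrite big_seq1 /=; apply.
- by move=> x [<-|[]].
(* No block has the negative total degree, so the condition is vacuous. *)
- by move=> b v hb; exfalso; lia.
- by exists k; split=> //; rewrite (_ : _ - _ = d)//; lia.
Qed.

Lemma eval_rel2 F g : admissible F -> rel2 proj rho g -> eval F g = 0.
Proof.
move=> [mF _ _ _] [k [u [w [hu ->]]]].
rewrite /eval !big_cons big_nil /= (@mode_act_homz _ k)//.
by rewrite subrr act_nil//= addr0 scaleN1r scale1r subrr.
Qed.

Lemma gam_nat l e k k' u v (n : nat) : homz k u -> homz k' v ->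
  k - 1 - l - e = n%:Z ->
  gam l e u v = \sum_(j < n.+1) bin n j *: mode u (l + j%:Z) v.
Proof.
move=> hu hv hn; pose N := (n + absz k + absz k' + absz l).+1.
rewrite (gam_homz HV (n := N) _ hu hv); last by lia.
rewrite hn (@sum_ord_truncate _ (fun j : nat => bin n j *: mode u (l + j%:Z) v) n.+1)//.
  by lia.
by move=> i ni; rewrite binz_nat bin_small ?scale0r.
Qed.

Lemma sum_iota (U : zmodType) n (f : nat -> U) :
  \sum_(i <- iota 0 n) f i = \sum_(i < n) f i.
Proof. by rewrite -(big_mkord xpredT) /index_iota subn0. Qed.

Lemma nrangeE n : nrange n%:Z = n.+1.
Proof. by []. Qed.

(** For fixed i the sum over j is a product [gam], which associativity turns into a sum of two-mode
    terms [Y (i + k)]. Summed over i, their coefficients collapse to the single term [Y 0], which is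
    u(p)v(q). *)
Lemma eval_rel3 F g : admissible F -> rel3 proj mode g -> eval F g = 0.
Proof.
move=> aF [ku [kv [u [v [p [q [s [w [d [hu hv hs [hq hd] ->]]]]]]]]]].
have {}hu : homz ku%:Z u := hu; have {}hv : homz kv%:Z v := hv.
have [mF _ _ _] := aF.
have mA x e : multilinear (act F x e) by exact: (multilinear_act HV HM).
set R := [seq (i, j) | i <- _, j <- _].
pose r := (1, act (act F u (ku%:Z - 1 - p)) v (kv%:Z - 1 - q)) ::
  [seq (- (bin (p - ku%:Z - d) ij.1 * bin (ku%:Z + d) ij.2),
        act F (mode u (p - ku%:Z - d - ij.1%:Z + ij.2%:Z) v)
          (ku%:Z + kv%:Z - p - q - 2)) | ij <- R].
transitivity (\sum_(x <- r) x.1 *: word_act x.2 s [::] w).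
  rewrite /eval /r !big_cons !big_map /=; congr (_ + _).
    by rewrite (@mode_act_homz F ku u p)// (@mode_act_homz _ kv v q).
  apply: eq_bigr => -[i j] _ /=.
  rewrite (mode_act_homz _ mF (mode_homz HV _ hu hv)).
  by congr (_ *: word_act (act _ _ _) _ _ _); lia.
apply: (word_act_vanish (d := d)) hs.
  move=> x; rewrite /r /= => -[<-|]; first exact: (multilinear_act HV HM).
  by move=> xR; have [y ->] := In_mapP xR; exact: mA.
move=> b {}w hb; rewrite /r big_cons big_map /= scale1r.
rewrite {r}/R -hb; rewrite -{}hb in hq hd.
set N := (ku + bdeg b)%N.
have -> : ku%:Z + (bdeg b)%:Z = N%:Z by [].
(* From t = n on, the mode of [v] in [Y t] would send [b] below degree 0. *)
pose n := absz (kv%:Z + (bdeg b)%:Z - q)%R.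
have -> : nrange (kv%:Z + (bdeg b)%:Z - q - 1) = n.
  by rewrite /nrange ifF; lia.
rewrite nrangeE big_allpairs_dep; set J := iota 0 N.+1; rewrite /= {}/J.
pose a := p - N%:Z; pose Y (t : nat) :=
  act (act F u (ku%:Z - 1 - p + t%:Z)) v (kv%:Z - 1 - q - t%:Z) b w.
have Y0 t : (n <= t)%N -> Y t = 0.
  move=> nt; apply: (@act_vanish _ _ _ _ _ _ _ ((bdeg b)%:Z + (kv%:Z - 1 - q - t%:Z))) => //.
  by move=> c x hc; exfalso; lia.
have aE : p - ku%:Z - (bdeg b)%:Z = a by rewrite /a /N PoszD; lia.
transitivity (Y 0 - \sum_(i < n) \sum_(k < n)
    (bin a i * ((-1) ^+ k * bin (a - i%:Z) k)) *: Y (i + k)%N).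
  congr (_ + _); first by rewrite /Y addr0 subr0.
  rewrite -sumrN sum_iota; apply: eq_bigr => i _.
  (* With l = a - i the exponent of 1 + x is [N], and l + e + deg b = -1 just meets the bound of
     [associativity]. *)
  have /eqP : defect proj mode rho F (a - i%:Z) (ku%:Z - 1 - p + i%:Z)
     (kv%:Z - 1 - q - i%:Z) n u v b w = 0.
    by apply: (associativity HV HM) => //; rewrite /a; lia.
  rewrite /defect subr_eq0 (gam_nat (n := N) hu hv); last by rewrite /a; lia.
  rewrite (linear_map_sum (act_linear_letter HV HM _ _ _ mF)) => /eqP H.
  transitivity (- (bin a i *: \sum_(j < N.+1) act F (bin N j *:
     mode u (a - i%:Z + j%:Z) v) (ku%:Z - 1 - p + i%:Z + (kv%:Z - 1 - q - i%:Z)) b w)).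
    rewrite sum_iota scaler_sumr -sumrN.
    apply: eq_bigr => j _; rewrite (linear_mapZ (act_linear_letter HV HM _ _ _ mF)).
    rewrite scalerA scaleNr aE; congr (- (_ *: act _ _ _ _ _)); lia.
  rewrite H scaler_sumr; congr (- _); apply: eq_bigr => k _; rewrite scalerA /Y.
  by congr (_ *: act (act _ _ _) _ _ _ _); lia.
rewrite (@sum_convolution _ _ (fun i k => bin a i * ((-1) ^+ k * bin (a - i%:Z) k)) Y)//.
(* C(a,i) C(a-i,t-i) = C(a,t) C(t,i), and the alternating sum of C(t,i) is (1-1)^t. *)
have c0 (t : nat) : \sum_(i < t.+1) bin a i * ((-1) ^+ (t - i) * bin (a - i%:Z) (t - i))
    = (t == 0)%:R.
  transitivity (bin a t * \sum_(i < t.+1) 'C(t, i)%:R * (-1) ^+ (t - i)).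
    rewrite mulr_sumr; apply: eq_bigr => i _.
    have := binz_trinomial K a i (t - i); rewrite subnKC -1?ltnS// => E.
    by rewrite mulrCA -E; ring.
  by rewrite sum_signed_bin; case: t => [|t]; rewrite ?binz0 ?mulr1 ?mulr0.
rewrite (eq_bigr (fun t : 'I_n => (t == 0 :> nat)%:R *: Y t)) => [|t _]; last first.
  by rewrite -c0.
case: n Y0 => [|n'] Y0.
  by rewrite big_ord0 Y0// subr0.
rewrite big_ord_recl big1 => [|t _]; last by rewrite scale0r.
by rewrite scale1r addr0 subrr.
Qed.

(** The bound on i makes f + deg b negative, so associativity holds with n = 0: there are no
    two-mode terms and the product [gam], which is the generator, acts by zero. *)
Lemma eval_J F g : admissible F -> J_gen proj mode g -> eval F g = 0.
Proof.
move=> aF [ku [kv [u [v [p [q [i [s [w [d [hu hv hs hi ->]]]]]]]]]]].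
have {}hu : homz ku%:Z u := hu; have {}hv : homz kv%:Z v := hv.
have [mF _ _ _] := aF.
have mA x e : multilinear (act F x e) by exact: (multilinear_act HV HM).
set R := iota _ _.
pose r := [seq (bin (ku%:Z + d) j,
  act F (mode u (p - i - j%:Z) v) (ku%:Z + kv%:Z - p - q - 2)) | j <- R].
transitivity (\sum_(x <- r) x.1 *: word_act x.2 s [::] w).
  rewrite /eval /r !big_map /=; apply: eq_bigr => j _ /=.
  rewrite (mode_act_homz _ mF (mode_homz HV _ hu hv)).
  by congr (_ *: word_act (act _ _ _) _ _ _); lia.
apply: (word_act_vanish (d := d)) hs.
  by move=> x xr; have [y ->] := In_mapP xr; exact: mA.
move=> b {}w hb; rewrite /r big_map /= {r}/R -hb.
have {}hi : (kv%:Z + (bdeg b)%:Z - q <= i)%R by rewrite hb.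
set N := (ku + bdeg b)%N.
have -> : ku%:Z + (bdeg b)%:Z = N%:Z by [].
have /eqP : defect proj mode rho F (p - i - N%:Z) (ku%:Z - 1 - p + i)
    (kv%:Z - 1 - q - i) 0 u v b w = 0.
  by apply: (associativity HV HM) => //; lia.
rewrite /defect big_ord0 subr0 (gam_nat (n := N) hu hv); last by lia.
rewrite (linear_map_sum (act_linear_letter HV HM _ _ _ mF)) => /eqP H.
rewrite nrangeE sum_iota -[RHS]H.
(* The generator lists the modes of [gam] in reverse order, j -> N - j. *)
rewrite (reindex_inj rev_ord_inj) /=; apply: eq_bigr => j _.
rewrite (linear_mapZ (act_linear_letter HV HM _ _ _ mF)) !binz_nat subSS bin_sub -1?ltnS//.
by congr (_ *: act _ (mode _ _ _) _ _ _); have := ltn_ord j; lia.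
Qed.

End Evaluation.

(** * From formal combinations to the intersection of J with M *)

Section FormalCombinations.
Variables (K : numFieldType) (V : lmodType K).
Variables (M U : lmodType K).

Lemma fc_eq_sum (h : word V * M -> U) (s t : fcomb V M) : fc_eq s t ->
  \sum_(x <- s) x.1 *: h x.2 = \sum_(x <- t) x.1 *: h x.2.
Proof.
(* Both sums are regrouped over the distinct basis pairs that occur in either. *)
move=> st; pose r := undup [seq x.2 | x <- s ++ t].
suff H (g : fcomb V M) : {subset [seq x.2 | x <- g] <= r} ->
    \sum_(x <- g) x.1 *: h x.2 = \sum_(b <- r) fcoef g b *: h b.
  rewrite !H; first by apply: eq_bigr => b _; rewrite st.
  - by move=> b hb; rewrite mem_undup map_cat mem_cat hb orbT.
  - by move=> b hb; rewrite mem_undup map_cat mem_cat hb.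
move=> gr; under [RHS]eq_bigr => b _ do rewrite /fcoef scaler_suml.
rewrite (exchange_big_dep xpredT)//=; apply: eq_big_seq => x xg.
rewrite big_mkcond (bigD1_seq x.2) ?undup_uniq ?gr ?map_f//= eqxx big1 ?addr0// => b.
by rewrite eq_sym => /negbTE ->.
Qed.

End FormalCombinations.

(** Evaluation at [proj_M] returns [w] on the left. On a term a.g it is [eval] of [g] at the
    admissible functional [word_act] of [proj_M] by [a], which vanishes for every generator. *)
Lemma J_cap_M0 (K : numFieldType) (V : lmodType K) (proj : nat -> V -> V)
  (mode : V -> int -> V -> V) (vac : V) (HV : is_Ngraded_VA proj mode vac)
  (M : lmodType K) (rho : V -> M -> M) (HM : is_AV_module proj mode vac rho) (w : M) :
  in_J proj mode rho [:: (1, ([::], w))] -> w = 0.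
Proof.
have admM := admissible_proj_M HV HM.
case=> r [hr /(@fc_eq_sum _ _ _ M (fun b =>
  word_act proj mode rho (@proj_M _ V M) b.1 [::] b.2))].
rewrite big_seq1 /= scale1r => ->.
rewrite /lincomb big_flatten big_map big_seq big1// => x /hr gx.
rewrite big_map /=.
under eq_bigr => y _ do rewrite -scalerA /word_act foldl_cat.
rewrite -scaler_sumr -[X in _ *: X]/(eval proj mode rho
   (word_act proj mode rho (@proj_M _ V M) x.2.1) x.2.2).
have admx := admissible_word_act HV HM x.2.1 admM.
suff -> : eval proj mode rho (word_act proj mode rho (@proj_M _ V M) x.2.1) x.2.2 = 0.
  by rewrite scaler0.
case: gx => [[]|].
- exact: (eval_multilin HV HM).
- exact: (eval_rel1 HV HM).
- exact: (eval_rel2 HV HM).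
- exact: (eval_rel3 HV HM).
- exact: (eval_J HV HM).
Qed.

(** The basis pair with vector 0 is not formally zero. Linearity in M with scalar -1 and both
    vectors 0 gives the relation [0] + [0] - [0], which is this pair. *)
Lemma in_I0 (K : numFieldType) (V : lmodType K) (proj : nat -> V -> V)
  (mode : V -> int -> V -> V) (M : lmodType K) (rho : V -> M -> M) :
  in_I proj mode rho [:: (1, ([::], 0))].
Proof.
exists [:: (1, ([::], [:: (1, ([::], (-1) *: 0 + 0)); (- (-1), ([::], 0));
   (-1, ([::], 0))]))]; split.
  by move=> x; rewrite inE => /eqP -> /=; constructor; right; exists (-1), [::], 0, 0.
move=> b; rewrite /fcoef /lincomb /= !big_cons !big_nil /= scaler0 !addr0.
by case: eqP => // _; ring.
Qed.

Theorem theorem5p2 (R : realType) (V : lmodType R[i]) (proj : nat -> V -> V)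
  (mode : V -> int -> V -> V) (vac : V)
  (HV : is_Ngraded_VA proj mode vac)
  (M : lmodType R[i]) (rho : V -> M -> M)
  (HM : is_AV_module proj mode vac rho) (w : M) :
  in_J proj mode rho [:: (1, ([::], w))] -> in_I proj mode rho [:: (1, ([::], w))].
Proof. by move=> /(J_cap_M0 HV HM) ->; exact: in_I0. Qed.
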